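(* For every fixed integer $d$, there is an incremental-polynomial time algorithm solving ICS-Enum on acyclic implicational bases $(X,\Sigma)$ such that, for every $x\in X$, the hypergraph $\mathcal{H}_x$ of premises having $x$ in their conclusion has dual-dimension at most $d$.
   Context: An implicational base $(X,\Sigma)$ is a set of implications $A\to B$ with $A,B\subseteq X$ disjoint; its closed sets are the $C$ with $A\subseteq C\Rightarrow B\subseteq C$ for all $A\to B\in\Sigma$, forming a closure system $\mathcal{C}$; $\mathrm{irr}(x)$ is the family of inclusion-maximal closed sets not containing $x$ and $\mathrm{irr}(\mathcal{C})=\bigcup_x\mathrm{irr}(x)$. ICS-Enum: given $(X,\Sigma)$, list $\mathrm{irr}(\mathcal{C})$. $\Sigma$ is acyclic if the digraph on $X$ with arcs $ab$ ($a\in A,b\in B$, $A\to B\in\Sigma$) is acyclic. $\mathcal{H}_x$ has edge set $\{A: A\to B\in\Sigma,\ x\in B\}$ on vertex set the union of these edges. The dual-dimension of a hypergraph is the maximum size of an inclusion-minimal set meeting all its edges. Incremental-polynomial time: the $i$-th output (and termination) occurs within time polynomial in $|X|+|\Sigma|$ plus $i$. *)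

(* Defs.v *)
From HB Require Import structures.
From mathcomp Require Import all_boot all_order all_algebra.
Set Implicit Arguments.
Unset Strict Implicit.
Unset Printing Implicit Defensive.

(* The implication A -> B is the pair (A, B). *)
Notation implication T := ({set T} * {set T})%type.

Section ImplicationalBases.
Variable T : finType.
Implicit Types (Sigma : {set implication T}) (E : {set {set T}}).

Definition implicational_base Sigma : Prop :=
  forall r, r \in Sigma -> [disjoint r.1 & r.2].

Definition closed_set Sigma : pred {set T} :=
  fun C => [forall r in Sigma, (r.1 \subset C) ==> (r.2 \subset C)].

Definition irr_at Sigma (x : T) : {set {set T}} :=
  [set M | maxset (fun C => closed_set Sigma C && (x \notin C)) M].

Definition irr Sigma : {set {set T}} := \bigcup_x irr_at Sigma x.

Definition implication_arc Sigma : rel T :=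
  fun a b => [exists r in Sigma, (a \in r.1) && (b \in r.2)].

Definition acyclic Sigma : Prop :=
  forall c : seq T, ucycle (implication_arc Sigma) c -> c = [::].

(* The hypergraph H_x, whose edges are the premises of the implications with x
   in their conclusion; its vertex set is the union [cover] of these edges. *)
Definition premises Sigma (x : T) : {set {set T}} :=
  [set r.1 | r in Sigma & x \in r.2].

Definition transversal_of E : pred {set T} :=
  fun Y => (Y \subset cover E) && [forall A in E, Y :&: A != set0].

(* This is 0 when E has an empty edge, hence no transversal at all. *)
Definition dual_dimension E : nat :=
  \max_(Y : {set T} | minset (transversal_of E) Y) #|Y|.

End ImplicationalBases.

(* Random access machine over nat, at unit cost per instruction.  Addition and
   truncated subtraction are the only arithmetic operations, so that running
   time is polynomially related to that of Turing machines.  A program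
   mentions finitely many registers by their index; the memory is reached by
   indirect addressing. *)
Inductive instr : Type :=
| Const of nat & nat          (* Const a k : r_a := k *)
| Add of nat & nat & nat      (* Add a b c : r_a := r_b + r_c *)
| Sub of nat & nat & nat      (* Sub a b c : r_a := r_b - r_c *)
| Read of nat & nat           (* Read a b : r_a := mem[r_b] *)
| Write of nat & nat          (* Write a b : mem[r_a] := r_b *)
| Jump of nat                 (* Jump l : goto l *)
| JumpZ of nat & nat          (* JumpZ a l : if r_a = 0 then goto l *)
| Put of nat                  (* Put a : append r_a to the word being written *)
| Emit.                       (* output the word being written, start anew *)

Definition program : Type := seq instr.

Record config : Type := Config {
  pc : nat;
  reg : nat -> nat;
  mem : nat -> nat;
  pending : seq nat;
  outputs : seq (seq nat)
}.

Definition upd (f : nat -> nat) (a v : nat) : nat -> nat :=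
  fun b => if b == a then v else f b.

Definition exec (i : instr) (c : config) : config :=
  let: Config l r m w o := c in
  match i with
  | Const a k => Config l.+1 (upd r a k) m w o
  | Add a b b' => Config l.+1 (upd r a (r b + r b')) m w o
  | Sub a b b' => Config l.+1 (upd r a (r b - r b')) m w o
  | Read a b => Config l.+1 (upd r a (m (r b))) m w o
  | Write a b => Config l.+1 r (upd m (r a) (r b)) w o
  | Jump l' => Config l' r m w o
  | JumpZ a l' => Config (if r a == 0 then l' else l.+1) r m w o
  | Put a => Config l.+1 r m (rcons w (r a)) o
  | Emit => Config l.+1 r m [::] (rcons o w)
  end.

Definition halted (P : program) (c : config) : bool := size P <= pc c.

Definition step (P : program) (c : config) : config :=
  if onth P (pc c) is Some i then exec i c else c.

Definition init (input : seq nat) : config :=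
  Config 0 (fun=> 0) (nth 0 input) [::] [::].

Definition run (P : program) (input : seq nat) (t : nat) : config :=
  iter t (step P) (init input).

(* On [input], P outputs every word of [sols] exactly once, in some order, and
   nothing else; the i-th output occurs within [time i] steps, and P halts
   within [time N] steps, N being the number of outputs. *)
Definition enumerates_within (P : program) (input : seq nat)
    (sols : seq (seq nat)) (time : nat -> nat) : Prop :=
  (forall i, i <= size sols -> i <= size (outputs (run P input (time i)))) /\
  let c := run P input (time (size sols)) in
  [/\ halted P c, pending c = [::] & perm_eq (outputs c) sols].

Definition bits n (A : {set 'I_n}) : seq nat :=
  [seq nat_of_bool (x \in A) | x <- enum 'I_n].

Definition encode_base n (s : seq (implication 'I_n)) : seq nat :=
  n :: size s :: flatten [seq bits r.1 ++ bits r.2 | r <- s].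

Definition encode_family n (F : {set {set 'I_n}}) : seq (seq nat) :=
  [seq bits C | C <- enum F].

(* Main.v *)
Require Import Defs.
From HB Require Import structures.
From mathcomp Require Import all_boot all_order all_algebra.
From mathcomp Require Import zify.
(* Imported again because [Sub] of eqtype hides the instruction [Sub]. *)
Require Import Defs.
Set Implicit Arguments.
Unset Strict Implicit.
Unset Printing Implicit Defensive.

(* If M is in irr(x), its complement contains a minimal transversal Y of H_x, and
   |Y| <= d.  Every y in Y has an arc to x; choose M_y in irr(y) containing M.
   Removing x from the intersection of the M_y leaves a closed set, since each
   premise yielding x meets Y; it avoids x and contains M, hence is M.  By
   induction along the arcs, a list L contains all irreducible closed sets as soon
   as no set S \ {x}, with S an intersection of at most d members of L, is a member
   of some irr(x) missing from L.  There are (|L| + 1)^d intersections S to try, so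
   looking for one more irreducible set takes time polynomial in n, |Sigma| and |L|.
   Membership in irr(x) is decided by forward chaining: C is in irr(x) iff x is not
   in the closure of C but is in the closure of C + y for each y outside C.

   The search is written in a structured language with bounded loops, whose
   semantics and cost are total functions, and compiled to the machine. *)

(** * Structured programs *)

(** The minimal transversals are never computed: the dual-dimension only bounds how many members of
    L have to be intersected. The program tries all such intersections with all x, and lets the
    irreducibility test reject the rest. When no implication yields x, Y is empty and the
    intersection is X itself; with L still empty this is the only intersection, so the family must
    contain it. A set may lie in irr(x) for several x and arise from several intersections;
    comparing each candidate with L keeps the outputs distinct. A pass either adds one set or shows
    that the list is complete, so N sets take N + 1 passes. The family of intersections is rebuilt
    in each pass: this costs a polynomial factor only, and lets L grow over the memory of the old
    family. A bounded loop reads its number of rounds on entry, so semantics and cost are structural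
    recursions. Only the loop over passes, whose number depends on the output, is written with
    machine jumps. *)

Record state : Type := State {
  rg : nat -> nat;
  mm : nat -> nat;
  pd : seq nat;
  ot : seq (seq nat)
}.

Definition conf (l : nat) (s : state) : config :=
  Config l (rg s) (mm s) (pd s) (ot s).

Definition sem_instr (i : instr) (s : state) : state :=
  match i with
  | Const a k => State (upd (rg s) a k) (mm s) (pd s) (ot s)
  | Add a b b' => State (upd (rg s) a (rg s b + rg s b')) (mm s) (pd s) (ot s)
  | Sub a b b' => State (upd (rg s) a (rg s b - rg s b')) (mm s) (pd s) (ot s)
  | Read a b => State (upd (rg s) a (mm s (rg s b))) (mm s) (pd s) (ot s)
  | Write a b => State (rg s) (upd (mm s) (rg s a) (rg s b)) (pd s) (ot s)
  | Put a => State (rg s) (mm s) (rcons (pd s) (rg s a)) (ot s)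
  | Emit => State (rg s) (mm s) [::] (rcons (ot s) (pd s))
  | _ => s
  end.

Definition basic (i : instr) : bool :=
  match i with Jump _ | JumpZ _ _ => false | _ => true end.

(* [For k a c] runs [c] as many times as the value of register [a], counting
   down in register [k] with register 0 as scratch. *)
Inductive cmd : Type :=
| Ins of instr
| Seq of cmd & cmd
| If of nat & cmd
| For of nat & nat & cmd.

Infix ";;" := Seq (at level 65, right associativity).

Definition for_init (k a : nat) (s : state) : state :=
  sem_instr (Add k k a) (sem_instr (Const k 0) s).

Definition for_dec (k : nat) (s : state) : state :=
  sem_instr (Sub k k 0) (sem_instr (Const 0 1) s).

Fixpoint sem (c : cmd) (s : state) : state :=
  match c with
  | Ins i => sem_instr i s
  | Seq c1 c2 => sem c2 (sem c1 s)
  | If a c => if rg s a == 0 then s else sem c s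
  | For k a c => iter (rg s a) (fun s' => for_dec k (sem c s')) (for_init k a s)
  end.

Definition for_body (k : nat) (c : cmd) (s : state) : state :=
  for_dec k (sem c s).

(** The exact number of machine steps of the compiled code. A loop spends 3 steps besides its rounds
    (two to set the counter, one for the test that exits) and 4 per round besides the body (test,
    constant 1, decrement, jump back). *)
Fixpoint cost (c : cmd) (s : state) : nat :=
  match c with
  | Ins i => 1
  | Seq c1 c2 => cost c1 s + cost c2 (sem c1 s)
  | If a c => 1 + (if rg s a == 0 then 0 else cost c s)
  | For k a c =>
      3 + \sum_(j < rg s a) (cost c (iter j (for_body k c) (for_init k a s)) + 4)
  end.

Definition instr_writes (i : instr) : seq nat :=
  match i with
  | Const a _ | Add a _ _ | Sub a _ _ | Read a _ => [:: a]
  | _ => [::]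
  end.

Fixpoint writes (c : cmd) : seq nat :=
  match c with
  | Ins i => instr_writes i
  | Seq c1 c2 => writes c1 ++ writes c2
  | If _ c => writes c
  | For k _ c => [:: 0, k & writes c]
  end.

Fixpoint silent (c : cmd) : bool :=
  match c with
  | Ins (Put _) | Ins Emit => false
  | Ins _ => true
  | Seq c1 c2 => silent c1 && silent c2
  | If _ c | For _ _ c => silent c
  end.

(** Under these conditions a counter reaches 0 after the intended number of rounds: it is cleared
    before [a] is read, register 0 carries the 1 to subtract, and the body leaves the counter
    alone. *)
Fixpoint wf (c : cmd) : bool :=
  match c with
  | Ins i => basic i
  | Seq c1 c2 => wf c1 && wf c2
  | If _ c => wf c
  | For k a c => [&& k != 0, k != a, k \notin writes c & wf c]
  end.

Fixpoint bounds (c : cmd) : seq nat :=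
  match c with
  | Ins i => [::]
  | Seq c1 c2 => bounds c1 ++ bounds c2
  | If _ c => bounds c
  | For _ a c => a :: bounds c
  end.

Fixpoint cost_bound (c : cmd) (Z : nat) : nat :=
  match c with
  | Ins i => 1
  | Seq c1 c2 => cost_bound c1 Z + cost_bound c2 Z
  | If _ c => 1 + cost_bound c Z
  | For _ _ c => 3 + Z * (cost_bound c Z + 4)
  end.

(** Jumps are absolute, hence the load address [l]. A loop has three instructions before its body,
    the test being at [l + 2], and three after it, so its exit is at [l + 6 + size p]. *)
Fixpoint compile (c : cmd) (l : nat) : program :=
  match c with
  | Ins i => [:: i]
  | Seq c1 c2 => let p1 := compile c1 l in p1 ++ compile c2 (l + size p1)
  | If a c => let p := compile c l.+1 in JumpZ a (l.+1 + size p) :: p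
  | For k a c =>
      let p := compile c (l + 3) in
      [:: Const k 0; Add k k a; JumpZ k (l + 6 + size p)] ++ p ++
      [:: Const 0 1; Sub k k 0; Jump (l + 2)]
  end.

Lemma sem_seq (c1 c2 : cmd) (s : state) : sem (c1;; c2) s = sem c2 (sem c1 s).
Proof. by []. Qed.

Lemma sem_if_true (a : nat) (c : cmd) (s : state) :
  rg s a != 0 -> sem (If a c) s = sem c s.
Proof. by rewrite /= => /negbTE->. Qed.

Lemma sem_if_false (a : nat) (c : cmd) (s : state) :
  rg s a = 0 -> sem (If a c) s = s.
Proof. by rewrite /= => ->. Qed.

Lemma sem_for (k a : nat) (c : cmd) (s : state) :
  sem (For k a c) s = iter (rg s a) (for_body k c) (for_init k a s).
Proof. by []. Qed.

Lemma frame_instr (i : instr) (s : state) (r : nat) :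
  r \notin instr_writes i -> rg (sem_instr i s) r = rg s r.
Proof. by case: i => //= [a k|a b c|a b c|a b]; rewrite inE /upd => /negbTE->. Qed.

Lemma for_dec_rg (k : nat) (s : state) (r : nat) :
  r \notin [:: 0; k] -> rg (for_dec k s) r = rg s r.
Proof. by rewrite !inE negb_or /= /upd => /andP[/negbTE-> /negbTE->]. Qed.

Lemma for_init_rg (k a : nat) (s : state) (r : nat) :
  r != k -> rg (for_init k a s) r = rg s r.
Proof. by rewrite /= /upd => /negbTE->. Qed.

Lemma frame (c : cmd) (s : state) (r : nat) :
  r \notin writes c -> rg (sem c s) r = rg s r.
Proof.
elim: c s => [i|c1 IH1 c2 IH2|a c IH|k a c IH] s.
- exact: frame_instr.
- by rewrite /= mem_cat negb_or => /andP[H1 H2]; rewrite IH2 ?IH1.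
- by move=> /= H; case: ifP => // _; apply: IH.
- rewrite /= 2!in_cons 2!negb_or => /and3P[r0 rk rc].
  elim: (rg s a) => [|j IHj]; first exact: for_init_rg.
  by rewrite iterS for_dec_rg ?IH // !inE negb_or r0.
Qed.

Lemma frame_out (c : cmd) (s : state) :
  silent c -> pd (sem c s) = pd s /\ ot (sem c s) = ot s.
Proof.
elim: c s => [i|c1 IH1 c2 IH2|a c IH|k a c IH] s.
- by case: i.
- move=> /= /andP[/IH1-/(_ s)[e1 e2] /IH2-/(_ (sem c1 s))[-> ->]].
  by rewrite e1 e2.
- by move=> /= H; case: ifP => // _; apply: IH.
- move=> /= H; elim: (rg s a) => //= j [e1 e2].
  by case: (IH (iter j (fun s' => for_dec k (sem c s')) (for_init k a s)) H) => -> ->.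
Qed.

(** The step receives the frame condition, so that an invariant need only mention what the loop
    changes. All rounds are covered, not just the last, because the cost of a loop depends on its
    intermediate states. *)
Lemma for_ind (I : nat -> state -> Prop) (k a : nat) (c : cmd) (s : state) :
  I 0 (for_init k a s) ->
  (forall j s', j < rg s a ->
     (forall r, r \notin writes (For k a c) -> rg s' r = rg s r) ->
     I j s' -> I j.+1 (for_body k c s')) ->
  forall j, j <= rg s a -> I j (iter j (for_body k c) (for_init k a s)).
Proof.
move=> I0 IS.
suff H j : j <= rg s a -> I j (iter j (for_body k c) (for_init k a s)) /\
    (forall r, r \notin writes (For k a c) ->
      rg (iter j (for_body k c) (for_init k a s)) r = rg s r).
  by move=> j /H[].
elim: j => [_|j IHj lj].
  split=> // r; rewrite /= 2!in_cons 2!negb_or => /and3P[r0 rk rc].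
  exact: for_init_rg.
have [Ij Fj] := IHj (ltnW lj); split; first exact: IS.
move=> r rn; rewrite -(Fj r) // iterS.
move: rn; rewrite [writes _]/= 2!in_cons 2!negb_or => /and3P[r0 rk rc].
by rewrite /for_body for_dec_rg ?frame // !inE negb_or r0.
Qed.

Lemma for_rule (I : nat -> state -> Prop) (k a : nat) (c : cmd) (s : state) :
  I 0 (for_init k a s) ->
  (forall j s', j < rg s a ->
     (forall r, r \notin writes (For k a c) -> rg s' r = rg s r) ->
     I j s' -> I j.+1 (for_body k c s')) ->
  I (rg s a) (sem (For k a c) s).
Proof. by move=> I0 IS; rewrite sem_for; apply: for_ind. Qed.

(** A bounding register that is never written has its initial value at every entry of its loop,
    however deep the nesting; so each loop makes at most [Z] rounds per entry. *)
Lemma cost_boundP (c : cmd) (s : state) (Z : nat) :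
  all (fun a => rg s a <= Z) (bounds c) ->
  all (fun a => (a != 0) && (a \notin writes c)) (bounds c) -> wf c ->
  cost c s <= cost_bound c Z.
Proof.
elim: c s => [i|c1 IH1 c2 IH2|a c IH|k a c IH] s //=.
- rewrite !all_cat => /andP[b1 b2] /andP[n1 n2] /andP[w1 w2].
  apply: leq_add.
    apply: IH1 => //; apply: sub_all n1 => r.
    by rewrite mem_cat negb_or => /and3P[-> ->].
  apply: IH2 => //; last first.
    by apply: sub_all n2 => r; rewrite mem_cat negb_or => /and3P[-> _ ->].
  apply/allP => r rb; rewrite frame; first exact: (allP b2).
  by move: (allP n2 r rb); rewrite mem_cat negb_or => /and3P[].
- move=> b n w; rewrite add1n ltnS; case: ifP => // _; exact: IH.
- move=> /andP[b0 b] /andP[n0 n] /and4P[k0 ka kw w].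
  rewrite leq_add2l.
  apply: (leq_trans (n := \sum_(j < rg s a) (cost_bound c Z + 4))); last first.
    by rewrite sum_nat_const card_ord leq_mul2r b0 orbT.
  apply: leq_sum => j _; rewrite leq_add2r; apply: IH => //; last first.
    apply: sub_all n => r; rewrite 2!in_cons 2!negb_or.
    by case/and3P => -> _ /andP[].
  apply/allP => r rb; suff -> : rg (iter j (for_body k c) (for_init k a s)) r = rg s r.
    exact: (allP b).
  have /= := allP n r rb; rewrite 2!in_cons 2!negb_or => /and4P[r0 _ rk rw].
  elim: (nat_of_ord j) => [|i IHi]; first exact: for_init_rg.
  by rewrite iterS /for_body for_dec_rg ?frame // !inE negb_or r0.
Qed.

Definition embedded (P : program) (l : nat) (p : program) : Prop :=
  exists p1 p2, P = p1 ++ p ++ p2 /\ size p1 = l.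

Lemma embedded_catl (P : program) (l : nat) (p q : program) :
  embedded P l (p ++ q) -> embedded P l p.
Proof. by case=> p1 [p2 [-> <-]]; exists p1, (q ++ p2); rewrite -catA. Qed.

Lemma embedded_catr (P : program) (l : nat) (p q : program) :
  embedded P l (p ++ q) -> embedded P (l + size p) q.
Proof.
case=> p1 [p2 [-> <-]]; exists (p1 ++ p), p2.
by rewrite -!catA size_cat.
Qed.

Lemma embedded_step (P : program) (l : nat) (i : instr) (p : program) (c : config) :
  embedded P l (i :: p) -> pc c = l -> step P c = exec i c.
Proof.
case=> p1 [p2 [-> <-]] e; rewrite /step e.
by elim: p1 {e} => //=.
Qed.

Lemma exec_basic (i : instr) (l : nat) (s : state) :
  basic i -> exec i (conf l s) = conf l.+1 (sem_instr i s).
Proof. by case: i. Qed.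

Lemma step_basic (P : program) (l : nat) (i : instr) (p : program) (s : state) :
  embedded P l (i :: p) -> basic i ->
  step P (conf l s) = conf l.+1 (sem_instr i s).
Proof. by move=> e b; rewrite (embedded_step e) // exec_basic. Qed.

Lemma comp_correct (c : cmd) (P : program) (l : nat) (s : state) :
  wf c -> embedded P l (compile c l) ->
  iter (cost c s) (step P) (conf l s) = conf (l + size (compile c l)) (sem c s).
Proof.
elim: c l s => [i|c1 IH1 c2 IH2|a c IH|k a c IH] l s; rewrite [wf _]/= [compile _ _]/=.
- by move=> w e; rewrite /= (step_basic _ e) // addn1.
- move=> /andP[w1 w2] e; rewrite [cost _ _]/= addnC iterD IH1 //; last exact: embedded_catl e.
  by rewrite IH2 ?size_cat ?addnA //; exact: embedded_catr e.
- move=> w e; rewrite [cost _ _]/= iterSr (embedded_step e) // /exec /=.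
  case: ifP => _ /=; first by rewrite addSnnS.
  rewrite -/(conf l.+1 s) IH ?addSnnS //.
  by have := embedded_catr (e : embedded _ _ ([:: _] ++ _)); rewrite addn1.
- move=> /and4P[k0 ka kw w] e.
  set p := compile c (l + 3) in e *.
  have e1 := embedded_catr (e : embedded _ _ ([:: _] ++ _)).
  have e2 : embedded P (l + 2) (JumpZ k (l + 6 + size p) :: p ++
      [:: Const 0 1; Sub k k 0; Jump (l + 2)]).
    exact: embedded_catr (e : embedded _ _ ([:: _; _] ++ _)).
  have e3 : embedded P (l + 3) (p ++ [:: Const 0 1; Sub k k 0; Jump (l + 2)]).
    exact: embedded_catr (e : embedded _ _ ([:: _; _; _] ++ _)).
  have e4 := embedded_catr e3.
  have e5 := embedded_catr (e4 : embedded _ _ ([:: _] ++ _)).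
  have e6 := embedded_catr (e4 : embedded _ _ ([:: _; _] ++ _)).
  set s0 := for_init k a s.
  have start : iter 2 (step P) (conf l s) = conf (l + 2) s0.
    by rewrite /= (step_basic _ e) // -addn1 (step_basic _ e1) // -addnS.
  have body s' : rg s' k != 0 ->
      iter (cost c s' + 4) (step P) (conf (l + 2) s') = conf (l + 2) (for_body k c s').
    move=> nz; have -> : cost c s' + 4 = 3 + (cost c s' + 1) by lia.
    rewrite !iterD [iter 1 _ _]/= (embedded_step e2) //= (negbTE nz) -/(conf _ s').
    rewrite -addnS.
    rewrite IH //; last exact: embedded_catl e3.
    rewrite -/p (step_basic _ e4) // -addn1 (step_basic _ e5) // -addnS.
    by rewrite (embedded_step e6).
  (* The counter holds the number of rounds left, so the test exits after exactly [rg s a]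
     rounds. *)
  have rgk j : j <= rg s a -> rg (iter j (for_body k c) s0) k = rg s a - j.
    elim: j => [_|j IHj lj].
      by rewrite /= /upd eqxx subn0 [a == k]eq_sym (negbTE ka).
    rewrite iterS /for_body /= /upd eqxx /= (negbTE k0) frame // IHj ?(ltnW lj) //.
    by rewrite subn1 -subnS.
  have loop j : j <= rg s a ->
     iter (\sum_(i < j) (cost c (iter i (for_body k c) s0) + 4)) (step P)
       (conf (l + 2) s0) = conf (l + 2) (iter j (for_body k c) s0).
    elim: j => [_|j IHj lj]; first by rewrite big_ord0.
    rewrite big_ord_recr /= addnC iterD IHj ?(ltnW lj) // body //.
    by rewrite rgk ?(ltnW lj) // -lt0n subn_gt0.
  have -> : cost (For k a c) s =
      (\sum_(j < rg s a) (cost c (iter j (for_body k c) s0) + 4)).+1 + 2.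
    by rewrite addnC.
  rewrite iterD start iterS loop // (embedded_step e2) //=.
  rewrite rgk // subnn eqxx size_cat /= -/(conf _ _).
  by congr (conf _ _); rewrite -/p; lia.
Qed.

(** * Closure and completeness *)

Section Closure.
Variable T : finType.
Implicit Types (r : implication T) (s : seq (implication T)) (S C D : {set T}).

Definition fire S r : {set T} := if r.1 \subset S then S :|: r.2 else S.
Definition fire_all s S : {set T} := foldl fire S s.
Definition closure_of s S : {set T} := iter #|T| (fire_all s) S.

Lemma sub_fire S r : S \subset fire S r.
Proof. by rewrite /fire; case: ifP => // _; apply: subsetUl. Qed.

Lemma sub_fire_all s S : S \subset fire_all s S.
Proof.
elim: s S => //= r s IH S; apply: subset_trans (sub_fire S r) _; exact: IH.
Qed.

(** A round that changes the set enlarges it, which can happen at most [#|T|] times. *)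
Lemma iter_inflationary_fix (F : {set T} -> {set T}) S :
  (forall S', S' \subset F S') -> F (iter #|T| F S) = iter #|T| F S.
Proof.
move=> infl.
have H k : F (iter k F S) = iter k F S \/ k <= #|iter k F S|.
  elim: k => [|k [e|le]]; first by right.
    by left; rewrite iterS e.
  have [e|ne] := eqVneq (F (iter k F S)) (iter k F S); first by left; rewrite iterS e.
  right; apply: leq_ltn_trans le _; apply: proper_card.
  by rewrite properEneq eq_sym ne infl.
case: (H #|T|) => // le; apply/eqP; rewrite eq_sym eqEsubset infl /=.
suff -> : iter #|T| F S = setT by apply: subsetT.
by apply/eqP; rewrite eqEcard subsetT cardsT.
Qed.

(** Firing never shrinks the set, so if a sweep ends where it began, every intermediate stage is [S]
    as well. *)
Lemma fire_all_fix s S : fire_all s S = S -> {in s, forall r, fire S r = S}.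
Proof.
elim: s => //= r s IH e.
have eS : fire S r = S.
  apply/eqP; rewrite eqEsubset sub_fire andbT -{2}e; exact: sub_fire_all.
by move=> r'; rewrite inE => /orP[/eqP->//|]; apply: IH; rewrite -{2}e eS.
Qed.

Lemma sub_closure s S : S \subset closure_of s S.
Proof.
rewrite /closure_of; elim: #|T| => //= k IH; apply: subset_trans IH _.
exact: sub_fire_all.
Qed.

Variables (Sigma : {set implication T}) (s : seq (implication T)).
Hypothesis sSigma : s =i Sigma.

Lemma closure_closed S : closed_set Sigma (closure_of s S).
Proof.
have /fire_all_fix H : fire_all s (closure_of s S) = closure_of s S.
  by apply: iter_inflationary_fix; apply: sub_fire_all.
apply/forall_inP => r; rewrite -sSigma => /H.
rewrite /fire; case: ifP => //= _ <-; exact: subsetUr.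
Qed.

Lemma closure_min S D : closed_set Sigma D -> S \subset D -> closure_of s S \subset D.
Proof.
move=> /forall_inP cD; rewrite /closure_of; elim: #|T| S => //= k IH S SD.
have : {subset s <= Sigma} by move=> r; rewrite sSigma.
move: (IH _ SD); rewrite /fire_all; elim: s (iter _ _ _) => //= r s' IHs S' S'D sub.
apply: IHs; last by move=> r' r's; apply: sub; rewrite inE r's orbT.
rewrite /fire; case: ifP => // rS; rewrite subUset S'D.
by apply: (implyP (cD r _)); rewrite ?sub ?mem_head //; apply: subset_trans rS _.
Qed.

(** [C] is not assumed closed: the second condition forces it, since an element of the closure
    outside [C] would bring [x] into the closure. *)
Lemma mem_irr_at C x : reflect
  (x \notin closure_of s C /\ forall y, y \in C \/ x \in closure_of s (y |: C))
  (C \in irr_at Sigma x).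
Proof.
rewrite inE; apply: (iffP maxsetP) => [[/andP[cC xC] maxC]|[xC H]].
  have clC : closure_of s C = C.
    by apply/eqP; rewrite eqEsubset sub_closure closure_min.
  split=> [|y]; first by rewrite clC.
  case: (boolP (y \in C)) => yC; first by left.
  right; apply/negPn/negP => nx; move/negP: yC; apply.
  rewrite -(maxC (closure_of s (y |: C))).
  - by apply: (subsetP (sub_closure _ _)); rewrite setU11.
  - by rewrite closure_closed nx.
  - by apply: subset_trans (sub_closure _ _); rewrite subsetUr.
(* With [D] the closure of [C], this gives closedness; with [D] any larger closed set avoiding [x],
   it gives maximality. *)
have up y D : closed_set Sigma D -> C \subset D -> y \in D -> x \notin D -> y \in C.
  move=> cD CD yD xD; case: (H y) => // xy; case/negP: xD.
  by apply: (subsetP (closure_min cD _) _ xy); rewrite subUset sub1set yD.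
have clC : closure_of s C = C.
  apply/eqP; rewrite eqEsubset sub_closure andbT; apply/subsetP => y yC.
  by apply: up yC xC; rewrite ?closure_closed ?sub_closure.
split; first by rewrite -{1}clC closure_closed -clC xC.
move=> D /andP[cD xD] CD; apply/eqP; rewrite eqEsubset CD andbT.
by apply/subsetP => y yD; apply: up yD xD.
Qed.
End Closure.

Section Completeness.
Variables (T : finType) (Sigma : {set implication T}) (d : nat).
Hypothesis acyclicSigma : acyclic Sigma.
Hypothesis dimSigma : forall x, dual_dimension (premises Sigma x) <= d.
Implicit Types (S C M : {set T}).

(** Induction on the number of ancestors of [x]. An arc from [y] to [x] leaves fewer to [y]: [x] is
    its own ancestor but, for lack of cycles, not an ancestor of [y]. *)
Lemma acyclic_ind (P : T -> Prop) :
  (forall x, (forall y, implication_arc Sigma y x -> P y) -> P x) -> forall x, P x.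
Proof.
pose e := implication_arc Sigma; pose down x := [set z | connect e z x].
move=> IH x; have [k] := ubnP #|down x|; elim: k x => // k IHk x; rewrite ltnS => lk.
apply: IH => y yx; apply: IHk; apply: leq_trans lk; apply: proper_card.
apply/properP; split.
  apply/subsetP => z; rewrite !inE => zy; exact: connect_trans zy (connect1 yx).
exists x; rewrite !inE ?connect0 //; apply/negP => /connectP[p xp ly].
(* [acyclic] speaks of cycles without repeated vertices, so the path from [x] to [y] is made simple
   before the arc closes it. *)
case/shortenP: xp ly => p' xp' u' _ ly.
suff /acyclicSigma : ucycle e (x :: p') by [].
by rewrite /ucycle u' andbT /= rcons_path xp' -ly; apply: yx.
Qed.

Lemma irr_at_above x C : closed_set Sigma C -> x \notin C ->
  exists2 M, M \in irr_at Sigma x & C \subset M.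
Proof.
move=> cC xC.
have [|M maxM CM] := @maxset_exists _ (fun D => closed_set Sigma D && (x \notin D)) C.
  by rewrite cC.
by exists M; rewrite ?inE.
Qed.

(** A premise yielding [x] and contained in the closed set [M] would put [x] in [M]; so the part of
    the cover outside [M] is a transversal, and a minimal one is taken inside it. *)
Lemma irr_at_transversal x M : M \in irr_at Sigma x ->
  exists Y : {set T}, [/\ #|Y| <= d, Y \subset cover (premises Sigma x),
    [disjoint Y & M] & forall A, A \in premises Sigma x -> Y :&: A != set0].
Proof.
rewrite inE => /maxsetP[/andP[/forall_inP cM xM] _].
have tr : transversal_of (premises Sigma x) (cover (premises Sigma x) :\: M).
  rewrite /transversal_of subsetDl; apply/forall_inP => A AH.
  have : ~~ (A \subset M).
    case/imsetP: (AH) => r; rewrite inE => /andP[rS xr] ->; apply/negP => rM.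
    have := implyP (cM r rS) rM.
    by move/subsetP/(_ x xr); apply/negP.
  case/subsetPn => a aA aM; apply/set0Pn; exists a.
  by rewrite !inE aM aA andbT; apply/bigcupP; exists A.
have [Y minY YM] := minset_exists tr.
have /minsetP[/andP[Yc /forall_inP Yt] _] := minY.
exists Y; split=> //.
- by apply: leq_trans (dimSigma x); apply: (@leq_bigmax_cond _ _ (fun Y : {set T} => #|Y|)).
- by rewrite disjoint_subset; apply: subset_trans YM _; apply/subsetP => z; rewrite !inE => /andP[].
Qed.

(** [L] stands for the sets found and [W] for the sets tried, both to be read off memory; [W] may
    contain more than the intersections. The induction has no separate base case: if no implication
    yields [x], then [Y] is empty and [S] is the full set. *)
Lemma irr_complete (L : pred {set T}) (W : {set T} -> Prop) :
  (forall l, size l <= d -> all L l -> W (\bigcap_(A <- l) A)) ->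
  (forall S x, W S -> S :\ x \in irr_at Sigma x -> L (S :\ x)) ->
  forall M, M \in irr Sigma -> L M.
Proof.
move=> WL LW M /bigcupP[x _]; elim/acyclic_ind: x M => x IH M Mx.
have [Y [Yd Yc YM Yt]] := irr_at_transversal Mx.
have := Mx; rewrite inE => /maxsetP[/andP[cM xM] maxM].
(* Outside [Y], the default [M] makes the choice function total. *)
have above y : exists N, (y \in Y -> N \in irr_at Sigma y) /\ M \subset N.
  case: (boolP (y \in Y)) => yY; last by exists M.
  have [|N Ny MN] := irr_at_above (x := y) cM; first by rewrite (disjointFr YM yY).
  by exists N.
have [f fP] : exists f : T -> {set T},
    forall y, (y \in Y -> f y \in irr_at Sigma y) /\ M \subset f y.
  have {}above y : exists N, ((y \in Y) ==> (N \in irr_at Sigma y)) && (M \subset N).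
    by case: (above y) => N [H1 H2]; exists N; rewrite H2 andbT; apply/implyP.
  exists (fun y => xchoose (above y)) => y.
  by case/andP: (xchooseP (above y)) => /implyP.
pose S := \bigcap_(A <- [seq f y | y <- enum Y]) A.
have SE : S = \bigcap_(y in Y) f y by rewrite /S big_map big_enum.
have WS : W S.
  apply: WL; first by rewrite size_map -cardE.
  apply/allP => N /mapP[y]; rewrite mem_enum => yY ->.
  apply: (IH y); last by apply: (fP y).1.
  case/bigcupP: (subsetP Yc y yY) => A /imsetP[r]; rewrite inE => /andP[rS xr] -> yr.
  by apply/existsP; exists r; rewrite rS yr.
have MS : M \subset S :\ x.
  rewrite subsetD1 xM andbT SE; apply/bigcapsP => y _; exact: (fP y).2.
have cS : closed_set Sigma (S :\ x).
  apply/forall_inP => r rS; apply/implyP => rSx.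
  have sub y : y \in Y -> S :\ x \subset f y.
    by move=> yY; rewrite SE; apply: subset_trans (subD1set _ _) _; apply: bigcap_inf.
  rewrite subsetD1; apply/andP; split.
    rewrite SE; apply/bigcapsP => y yY.
    have := (fP y).1 yY; rewrite inE => /maxsetP[/andP[/forall_inP cf _] _].
    by apply: (implyP (cf r rS)); apply: subset_trans rSx (sub y yY).
  (* Such a premise has an element [y] in [Y]; it lies in [S], hence in [f y], which avoids [y]. *)
  apply/negP => xr.
  have /Yt/set0Pn[y] : r.1 \in premises Sigma x.
    by apply/imsetP; exists r; rewrite // inE rS.
  rewrite inE => /andP[yY yr].
  have := (fP y).1 yY; rewrite inE => /maxsetP[/andP[_ /negP yf] _]; apply: yf.
  by apply: (subsetP (sub y yY)); apply: (subsetP rSx).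
have e : S :\ x = M by apply: maxM MS; rewrite cS !inE eqxx.
by rewrite -e; apply: LW; rewrite ?e.
Qed.
End Completeness.

(** * Sets in memory *)

(** The offset skips the two cells that hold [n] and the number of implications. *)
Definition ptr (n j : nat) : nat := 2 + j * n.

Definition slot n (m : nat -> nat) (j : nat) : {set 'I_n} :=
  [set i : 'I_n | m (ptr n j + i) != 0].

(** With cells restricted to 0 and 1, a slot determines its cells and arithmetic can serve as logic.
    Addresses 0 and 1 are exempt because they hold the two counts of the input. *)
Definition bitmem (m : nat -> nat) : Prop := forall a, 1 < a -> m a <= 1.

Lemma ptr_inj n j j' (i i' : 'I_n) :
  (ptr n j + i == ptr n j' + i') = (j == j') && (i == i').
Proof.
apply/eqP/andP => [e|[/eqP-> /eqP->] //].
have n0 : 0 < n by apply: leq_ltn_trans (ltn_ord i).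
have {}e : j * n + i = j' * n + i' by move: e; rewrite /ptr; lia.
have ej : j = j'.
  by have := congr1 (divn^~ n) e; rewrite !divnMDl // !divn_small ?ltn_ord // !addn0.
rewrite ej eqxx; split=> //; apply/eqP/val_inj => /=; move: e; rewrite ej; lia.
Qed.

Lemma ptrS n j : ptr n j + n = ptr n j.+1.
Proof. by rewrite /ptr mulSn; lia. Qed.

Lemma cellE n (m : nat -> nat) j (i : 'I_n) :
  bitmem m -> m (ptr n j + i) = (i \in slot n m j).
Proof.
move=> /(_ (ptr n j + i) isT); rewrite inE; by case: (m _) => [|[]].
Qed.

Lemma in_slot_upd n (m : nat -> nat) j j' (i i' : 'I_n) v :
  (i' \in slot n (upd m (ptr n j + i) v) j') =
  if (j' == j) && (i' == i) then v != 0 else i' \in slot n m j'.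
Proof. by rewrite !inE /upd ptr_inj; case: ifP. Qed.

Lemma slot_upd n (m : nat -> nat) j (i : 'I_n) v j' :
  slot n (upd m (ptr n j + i) v) j' =
  if j' == j then (if v == 0 then slot n m j :\ i else i |: slot n m j)
  else slot n m j'.
Proof.
apply/setP => i'; rewrite in_slot_upd.
case: eqP => [->|_] //=; case: (v == 0); rewrite [RHS]inE ?inE.
  by case: eqP.
by case: eqP.
Qed.

Lemma bitmem_upd (m : nat -> nat) a v : bitmem m -> v <= 1 -> bitmem (upd m a v).
Proof. by move=> bm v1 b /bm; rewrite /upd; case: ifP. Qed.

(** * The input read as slots *)

Section Encoding.
Variable n : nat.
Implicit Types (ss : seq {set 'I_n}) (sg : seq (implication 'I_n)).

Definition input_sets sg : seq {set 'I_n} := flatten [seq [:: r.1; r.2] | r <- sg].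

Lemma nth_input_sets sg k : k < size sg ->
  nth (set0, set0) sg k =
    (nth set0 (input_sets sg) k.*2, nth set0 (input_sets sg) k.*2.+1).
Proof. by elim: sg k => // -[A B] sg IH [|k] //= /IH. Qed.

Lemma flatten_bits sg :
  flatten [seq bits r.1 ++ bits r.2 | r <- sg] = flatten [seq bits A | A <- input_sets sg].
Proof. by elim: sg => //= r sg ->; rewrite catA. Qed.

Lemma nth_flatten_bits ss j (i : 'I_n) :
  nth 0 (flatten [seq bits A | A <- ss]) (j * n + i) = (i \in nth set0 ss j).
Proof.
have size_bits (A : {set 'I_n}) : size (bits A) = n by rewrite size_map size_enum_ord.
elim: ss j => [|A ss IH] [|j]; rewrite ?nth_nil ?inE //= nth_cat size_bits.
  by rewrite mul0n add0n ltn_ord (nth_map i) ?size_enum_ord // nth_ord_enum.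
by rewrite mulSn -addnA ltnNge leq_addr addKn IH.
Qed.

Lemma slot_encode_base sg j : slot n (nth 0 (encode_base sg)) j = nth set0 (input_sets sg) j.
Proof.
apply/setP => i; rewrite inE /encode_base flatten_bits /ptr -addnA !add2n /=.
by rewrite nth_flatten_bits; case: (i \in _).
Qed.

Lemma bitmem_encode_base sg : bitmem (nth 0 (encode_base sg)).
Proof.
move=> [|[|a]] // _; rewrite /encode_base flatten_bits /=.
have [/(mem_nth 0) /flatten_mapP[A _ /mapP[i _ ->]]|le] :=
  ltnP a (size (flatten [seq bits A | A <- input_sets sg])); first by case: (i \in A).
by rewrite nth_default.
Qed.
End Encoding.

Opaque ptr.

(* The set in slot j occupies the n cells from address [ptr n j] on; with m
   implications, slots 0 to 2m - 1 are the input.  Next come S = 2m (closure being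
   computed), C = 2m + 1 (candidate), F = 2m + 2 (new irreducible set), then the
   list L of the N sets found so far, and the family W of their intersections.
   Register 0 is scratch; 2, 3, 4 hold n, m, N; 5 to 9 point to S, C, F, L, W; 10
   holds |W|, 11 tells whether F is set, 12 holds d; 13 to 22 serve [zipwith], 23 to
   26 the closure, 27 to 33 the construction of W, 34 to 43 the search in W and
   44 to 46 the output. *)
Definition inc a : cmd := Ins (Const 0 1);; Ins (Add a a 0).
Definition copy a b : cmd := Ins (Const a 0);; Ins (Add a a b).

(* [zipwith p q w op] sets each cell of the block at [w] to the value that [op]
   computes in register 19 from the corresponding cells of the blocks at [p] and
   [q], held in registers 17 and 18; [op] accumulates in register 21 and may
   consult register 22. *)
Definition zip_init p q w : cmd :=
  copy 14 p;; copy 15 q;; copy 16 w;; Ins (Const 21 0).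
Definition zip_body op : cmd :=
  Ins (Read 17 14);; Ins (Read 18 15);; op;; Ins (Write 16 19);;
  inc 14;; inc 15;; inc 16.
Definition zipwith p q w op : cmd := zip_init p q w;; For 13 2 (zip_body op).

(** The writable registers exclude the pointers 14 to 16 and the parameter 22, which must survive
    all positions. The contribution [g] to register 21 turns a sweep into a count, such as that of
    the violations of an inclusion. *)
Definition op_spec (op : cmd) (f : bool -> bool -> nat -> bool)
    (g : bool -> bool -> nat) : Prop :=
  {subset writes op <= [:: 0; 19; 20; 21]} /\
  forall s (b1 b2 : bool), rg s 17 = b1 -> rg s 18 = b2 ->
    [/\ mm (sem op s) = mm s, rg (sem op s) 19 = f b1 b2 (rg s 22)
      & rg (sem op s) 21 = rg s 21 + g b1 b2].

(** The target may be one of the sources: cell [k] is read before it is written, and the invariant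
    keeps the cells from [k] on in their original state. *)
Lemma zip_spec n s p q w op f g jp jq jw :
  bitmem (mm s) -> rg s 2 = n ->
  p \notin [:: 14; 15; 16; 21] -> q \notin [:: 14; 15; 16; 21] ->
  w \notin [:: 14; 15; 16; 21] ->
  rg s p = ptr n jp -> rg s q = ptr n jq -> rg s w = ptr n jw ->
  op_spec op f g ->
  let s' := sem (zipwith p q w op) s in
  [/\ bitmem (mm s'),
    forall j, slot n (mm s') j =
      if j == jw then
        [set i | f (i \in slot n (mm s) jp) (i \in slot n (mm s) jq) (rg s 22)]
      else slot n (mm s) j
    & rg s' 21 =
      \sum_(i < n) g (i \in slot n (mm s) jp) (i \in slot n (mm s) jq)].
Proof.
move=> bm rn; rewrite !inE !negb_or.
case/and4P=> p1 p2 p3 p4 /and4P[q1 q2 q3 q4] /and4P[w1 w2 w3 w4] ep eq ew [wop opP].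
pose s1 := sem (zip_init p q w) s.
rewrite -[sem (zipwith p q w op) s]/(sem (For 13 2 (zip_body op)) s1).
have e14 : rg s1 14 = ptr n jp by rewrite /s1 /= /upd /= (negbTE p1) add0n.
have e15 : rg s1 15 = ptr n jq.
  by rewrite /s1 /= /upd /= (negbTE q2) (negbTE q1) add0n.
have e16 : rg s1 16 = ptr n jw.
  by rewrite /s1 /= /upd /= (negbTE w3) (negbTE w2) (negbTE w1) add0n.
have e21 : rg s1 21 = 0 by [].
have e22 : rg s1 22 = rg s 22 by [].
have e2 : rg s1 2 = n by rewrite -rn.
have em : mm s1 = mm s by [].
rewrite -{}em in bm *; rewrite -e22; clearbody s1.
pose A := slot n (mm s1) jp; pose B := slot n (mm s1) jq; pose c := rg s1 22.
pose I k s' := [/\ bitmem (mm s'),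
  forall j (i : 'I_n), (i \in slot n (mm s') j) =
    if (j == jw) && (i < k) then f (i \in A) (i \in B) c else i \in slot n (mm s1) j,
  rg s' 21 = \sum_(i < n | i < k) g (i \in A) (i \in B),
  rg s' 22 = c &
  [/\ rg s' 14 = ptr n jp + k, rg s' 15 = ptr n jq + k & rg s' 16 = ptr n jw + k]].
have := @for_rule I 13 2 (zip_body op) s1.
rewrite e2 => /(_ _ _)[].
- split=> //.
  + by move=> j i; rewrite ltn0 andbF.
  + by rewrite big1 ?e21.
  + by rewrite !addn0.
- move=> k s' ltkn _ [bm' sl' e21' e22' [e14' e15' e16']].
  pose s2 := sem_instr (Read 18 15) (sem_instr (Read 17 14) s').
  pose i0 := Ordinal ltkn.
  have cell j : j = jp \/ j = jq -> mm s' (ptr n j + k) = (i0 \in slot n (mm s1) j).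
    by move=> _; rewrite -[k]/(nat_of_ord i0) cellE // sl' ltnn andbF.
  have [] := opP s2 (i0 \in A) (i0 \in B).
  + by rewrite /s2 /= /upd /= e14' cell //; left.
  + by rewrite /s2 /= /upd /= e15' cell //; right.
  rewrite [mm s2]/= [rg s2 22]/= [rg s2 21]/= /upd /= e22' e21' => em e19 e21''.
  have fr r : r \in [:: 14; 15; 16; 22] -> rg (sem op s2) r = rg s' r.
    move=> rr; rewrite frame; last by apply/negP => /wop; move: rr; rewrite !inE => /or4P[]/eqP->.
    by move: rr; rewrite /s2 /= /upd !inE => /or4P[]/eqP->.
  rewrite (_ : for_body 13 (zip_body op) s' =
    for_dec 13 (sem (Ins (Write 16 19);; inc 14;; inc 15;; inc 16) (sem op s2))) //.
  move: (sem op s2) em e19 e21'' fr => s3 em e19 e21'' fr.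
  have f14 := fr 14 isT; have f15 := fr 15 isT; have f16 := fr 16 isT.
  have f22 := fr 22 isT.
  rewrite /I /= /upd /= -/(upd _ _ _) em f14 f15 f16 f22 e19 e21'' e14' e15' e16'.
  rewrite !addn1 -!addnS; split=> //.
  + by apply: bitmem_upd => //; case: (f _ _ _).
  + move=> j i; rewrite -[ptr n jw + k]/(ptr n jw + i0) in_slot_upd sl' ltnS.
    rewrite -val_eqE /=; case: (j == jw) => //=; case: ltngtP => // e.
    by rewrite (_ : i = i0); [case: (f _ _ _)|exact: val_inj].
  + rewrite (bigD1 i0 (P := fun i : 'I_n => i < k.+1)) //= addnC; congr (_ + _).
    apply: eq_bigl => i; rewrite ltnS -val_eqE /= ltn_neqAle andbC //.
- move=> bm' sl' e21' e22' _; split=> //.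
  + move=> j; apply/setP => i; rewrite sl' ltn_ord andbT.
    by case: ifP => // _; rewrite inE.
  + by rewrite e21'; apply: eq_bigl => i; rewrite ltn_ord.
Qed.

(** The whole memory becomes an infinite array of sets: commands act by [setslot], and separation is
    inequality of indices. *)
Definition holds n (s : state) (V : nat -> {set 'I_n}) : Prop :=
  bitmem (mm s) /\ slot n (mm s) =1 V.

Definition setslot n (V : nat -> {set 'I_n}) (j : nat) (S : {set 'I_n}) :
  nat -> {set 'I_n} := fun j' => if j' == j then S else V j'.

Lemma holds_ext n s (V V' : nat -> {set 'I_n}) : V =1 V' -> holds s V -> holds s V'.
Proof. by move=> e [bm sl]; split=> // j; rewrite sl. Qed.

Lemma holds_dec n k s (V : nat -> {set 'I_n}) : holds s V -> holds (for_dec k s) V.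
Proof. by []. Qed.

Lemma holds_ins n i s (V : nat -> {set 'I_n}) :
  (if i is Write _ _ then false else true) -> holds s V -> holds (sem (Ins i) s) V.
Proof. by case: i. Qed.

Lemma holds_init n k a s (V : nat -> {set 'I_n}) :
  holds s V -> holds (for_init k a s) V.
Proof. by []. Qed.

Lemma setslot_id n (V : nat -> {set 'I_n}) j : setslot V j (V j) =1 V.
Proof. by move=> j'; rewrite /setslot; case: eqP => [->|]. Qed.

Lemma setslot_same n (V : nat -> {set 'I_n}) j S S' :
  setslot (setslot V j S) j S' =1 setslot V j S'.
Proof. by move=> j'; rewrite /setslot; case: eqP. Qed.

Lemma setslotE n (V : nat -> {set 'I_n}) j S : setslot V j S j = S.
Proof. by rewrite /setslot eqxx. Qed.

Lemma setslotN n (V : nat -> {set 'I_n}) j S j' :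
  j' != j -> setslot V j S j' = V j'.
Proof. by rewrite /setslot => /negbTE->. Qed.

(** * Bitwise operations by truncated subtraction *)

Definition op_copy : cmd := copy 19 17.
(** On bits, [a - b] is 1 exactly when [a] holds and [b] fails. *)
Definition op_and : cmd := Ins (Sub 20 17 18);; Ins (Sub 19 17 20).
(** Meant for a target equal to the second operand: its bits are written back unchanged, and only
    the count in register 21 matters. *)
Definition op_sub : cmd :=
  copy 19 18;; Ins (Sub 20 17 18);; Ins (Add 21 21 20).
(** The union takes place only if register 22 is 0; otherwise the first subtraction erases the bit
    to be added. *)
Definition op_or : cmd :=
  Ins (Sub 20 17 22);; Ins (Sub 20 20 18);; Ins (Add 19 18 20).
Definition op_eq : cmd := op_sub;; Ins (Sub 20 18 17);; Ins (Add 21 21 20).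
Definition op_one : cmd := Ins (Const 19 1).

Lemma op_copy_spec : op_spec op_copy (fun a _ _ => a) (fun _ _ => 0).
Proof.
split; first by apply/allP.
by move=> s a b /= e1 e2; rewrite /upd /= e1 addn0.
Qed.

Lemma op_and_spec : op_spec op_and (fun a b _ => a && b) (fun _ _ => 0).
Proof.
split; first by apply/allP.
by move=> s a b /= e1 e2; rewrite /upd /= e1 e2 addn0; case: a {e1}; case: b {e2}.
Qed.

Lemma op_sub_spec : op_spec op_sub (fun _ b _ => b) (fun a b => a && ~~ b).
Proof.
split; first by apply/allP.
by move=> s a b /= e1 e2; rewrite /upd /= e1 e2; case: a {e1}; case: b {e2}.
Qed.

Lemma op_or_spec :
  op_spec op_or (fun a b c => b || a && (c == 0)) (fun _ _ => 0).
Proof.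
split; first by apply/allP.
move=> s a b /= e1 e2; rewrite /upd /= e1 e2 addn0.
by case: a {e1}; case: b {e2}; case: (rg s 22) => [|[]].
Qed.

Lemma op_eq_spec : op_spec op_eq (fun _ b _ => b) (fun a b => a != b).
Proof.
split; first by apply/allP.
move=> s a b /= e1 e2; rewrite /upd /= e1 e2.
by case: a {e1}; case: b {e2}; rewrite ?addn0.
Qed.

Lemma op_one_spec : op_spec op_one (fun _ _ _ => true) (fun _ _ => 0).
Proof. by split; [apply/allP|move=> s a b /= e1 e2; rewrite /upd /= addn0]. Qed.

Definition zip_reg r := r \notin [:: 14; 15; 16; 21].

Section ZipOps.
Variables (n : nat) (s : state) (V : nat -> {set 'I_n}).
Hypotheses (hV : holds s V) (hn : rg s 2 = n).

Lemma zip_holds p q w op f g jp jq jw :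
  zip_reg p -> zip_reg q -> zip_reg w ->
  rg s p = ptr n jp -> rg s q = ptr n jq -> rg s w = ptr n jw ->
  op_spec op f g ->
  let s' := sem (zipwith p q w op) s in
  holds s' (setslot V jw [set i | f (i \in V jp) (i \in V jq) (rg s 22)]) /\
  rg s' 21 = \sum_(i < n) g (i \in V jp) (i \in V jq).
Proof.
case: hV => bm sl zp zq zw ep eq ew opP.
have [bm' sl' e21] := zip_spec bm hn zp zq zw ep eq ew opP.
split; last by rewrite e21 !sl.
by split=> // j; rewrite sl' /setslot !sl.
Qed.

Lemma copy_holds p w jp jw : zip_reg p -> zip_reg w ->
  rg s p = ptr n jp -> rg s w = ptr n jw ->
  holds (sem (zipwith p p w op_copy) s) (setslot V jw (V jp)).
Proof.
move=> zp zw ep ew.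
have [H _] := zip_holds zp zp zw ep ep ew op_copy_spec.
by apply: holds_ext H => j; rewrite /setslot; case: eqP => // _; apply/setP => i; rewrite inE.
Qed.

Lemma and_holds p q w jp jq jw : zip_reg p -> zip_reg q -> zip_reg w ->
  rg s p = ptr n jp -> rg s q = ptr n jq -> rg s w = ptr n jw ->
  holds (sem (zipwith p q w op_and) s) (setslot V jw (V jp :&: V jq)).
Proof.
move=> zp zq zw ep eq ew.
have [H _] := zip_holds zp zq zw ep eq ew op_and_spec.
by apply: holds_ext H => j; rewrite /setslot; case: eqP => // _; apply/setP => i; rewrite !inE.
Qed.

Lemma or_holds p q jp jq : zip_reg p -> zip_reg q ->
  rg s p = ptr n jp -> rg s q = ptr n jq ->
  holds (sem (zipwith p q q op_or) s)
    (setslot V jq (if rg s 22 == 0 then V jq :|: V jp else V jq)).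
Proof.
move=> zp zq ep eq.
have [H _] := zip_holds zp zq zq ep eq eq op_or_spec.
apply: holds_ext H => j; rewrite /setslot; case: ifP => // _.
apply/setP => i; rewrite !inE; case: eqP; rewrite ?inE ?andbT ?andbF ?orbF //.
Qed.

Lemma one_holds w jw : zip_reg w -> rg s w = ptr n jw ->
  holds (sem (zipwith w w w op_one) s) (setslot V jw setT).
Proof.
move=> zw ew.
have [H _] := zip_holds zw zw zw ew ew ew op_one_spec.
by apply: holds_ext H => j; rewrite /setslot; case: eqP => // _; apply/setP => i; rewrite !inE.
Qed.

Lemma sub_holds p q jp jq : zip_reg p -> zip_reg q ->
  rg s p = ptr n jp -> rg s q = ptr n jq ->
  let s' := sem (zipwith p q q op_sub) s in
  holds s' V /\ (rg s' 21 == 0) = (V jp \subset V jq).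
Proof.
move=> zp zq ep eq.
have [H e] := zip_holds zp zq zq ep eq eq op_sub_spec; split.
  apply: holds_ext H => j; rewrite /setslot; case: eqP => // ->.
  by apply/setP => i; rewrite inE.
rewrite e sum_nat_eq0; apply/forall_inP/subsetP => H' i.
  by move=> ip; have := H' i isT; rewrite ip /=; case: (i \in V jq).
by move=> _; case: (boolP (i \in V jp)) => //= /H' ->.
Qed.

Lemma eq_holds p q jp jq : zip_reg p -> zip_reg q ->
  rg s p = ptr n jp -> rg s q = ptr n jq ->
  let s' := sem (zipwith p q q op_eq) s in
  holds s' V /\ (rg s' 21 == 0) = (V jp == V jq).
Proof.
move=> zp zq ep eq.
have [H e] := zip_holds zp zq zq ep eq eq op_eq_spec; split.
  apply: holds_ext H => j; rewrite /setslot; case: eqP => // ->.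
  by apply/setP => i; rewrite inE.
rewrite e sum_nat_eq0; apply/forall_inP/eqP => [H'|-> i _]; last by rewrite eqxx.
by apply/setP => i; have := H' i isT; case: (i \in V jp); case: (i \in V jq).
Qed.

End ZipOps.

Opaque zipwith.

(** * Forward chaining on the machine *)

Ltac regs := rewrite /= /upd /=.

Definition fire_cmd : cmd :=
  zipwith 25 5 5 op_sub;; copy 22 21;; Ins (Add 26 25 2);; zipwith 26 5 5 op_or;;
  Ins (Add 25 26 2).

Definition closure_cmd : cmd := For 23 2 (Ins (Const 25 2);; For 24 3 fire_cmd).

Lemma fire_holds n s (V : nat -> {set 'I_n}) jS j :
  holds s V -> rg s 2 = n -> rg s 5 = ptr n jS -> rg s 25 = ptr n j ->
  let s' := sem fire_cmd s in
  holds s' (setslot V jS (fire (V jS) (V j, V j.+1))) /\ rg s' 25 = ptr n j.+2.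
Proof.
move=> hV hn h5 h25.
rewrite /fire_cmd 4!sem_seq.
have [hV1 e21] := sub_holds hV hn (isT : zip_reg 25) (isT : zip_reg 5) h25 h5.
have f2 : rg (sem (zipwith 25 5 5 op_sub) s) 2 = n by rewrite frame.
have f5 : rg (sem (zipwith 25 5 5 op_sub) s) 5 = ptr n jS by rewrite frame.
have f25 : rg (sem (zipwith 25 5 5 op_sub) s) 25 = ptr n j by rewrite frame.
move: (sem _ s) hV1 e21 f2 f5 f25 => s1 hV1 e21 f2 f5 f25 {hV hn h5 h25}.
pose s2 := sem (Ins (Add 26 25 2)) (sem (copy 22 21) s1); rewrite -/s2.
have g26 : rg s2 26 = ptr n j.+1 by rewrite /s2; regs; rewrite f25 f2 ptrS.
have g22 : rg s2 22 = rg s1 21 by rewrite /s2; regs.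
have hV2 : holds s2 V by [].
have g2 : rg s2 2 = n by rewrite -f2.
have g5 : rg s2 5 = ptr n jS by rewrite -f5.
clearbody s2; have := or_holds hV2 g2 (isT : zip_reg 26) (isT : zip_reg 5) g26 g5.
rewrite g22 e21 => H; split=> //.
rewrite -[LHS]/(rg (sem (zipwith 26 5 5 op_or) s2) 26 + rg (sem (zipwith 26 5 5 op_or) s2) 2).
by rewrite !frame // g26 g2 ptrS.
Qed.

Opaque fire_cmd.

Definition inputs n (sg : seq (implication 'I_n)) (V : nat -> {set 'I_n}) : Prop :=
  forall r, r < size sg -> nth (set0, set0) sg r = (V r.*2, V r.*2.+1).

Lemma inputs_setslot n (sg : seq (implication 'I_n)) (V : nat -> {set 'I_n}) j S :
  (size sg).*2 <= j -> inputs sg V -> inputs sg (setslot V j S).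
Proof. by move=> lej inV r lr; rewrite inV // !setslotN //; lia. Qed.

Section ClosureCmd.
Variables (n : nat) (sg : seq (implication 'I_n)) (jS : nat).
Hypothesis jS_ge : (size sg).*2 <= jS.

Lemma fire_all_holds s (V : nat -> {set 'I_n}) :
  holds s V -> inputs sg V -> rg s 2 = n -> rg s 3 = size sg -> rg s 5 = ptr n jS ->
  holds (sem (Ins (Const 25 2);; For 24 3 fire_cmd) s)
    (setslot V jS (fire_all sg (V jS))).
Proof.
move=> hV inV hn hm h5.
pose s1 := sem (Ins (Const 25 2)) s.
rewrite -[sem _ s]/(sem (For 24 3 fire_cmd) s1).
pose I k s' := holds s' (setslot V jS (fire_all (take k sg) (V jS))) /\
  rg s' 25 = ptr n k.*2.
have := @for_rule I 24 3 fire_cmd s1; rewrite [rg s1 3]hm => /(_ _ _)[]; last by rewrite take_size.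
- split=> //; rewrite take0; apply: holds_init.
  have hV1 : holds s1 V by [].
  by apply: holds_ext hV1 => j; rewrite setslot_id.
- move=> k s' ltk fr [hs h25].
  have f2 : rg s' 2 = n by rewrite fr.
  have f5 : rg s' 5 = ptr n jS by rewrite fr.
  have [H25 e25] := fire_holds hs f2 f5 h25.
  split; last by rewrite for_dec_rg // e25 doubleS.
  apply: holds_dec; apply: holds_ext H25 => j.
  rewrite setslot_same setslotE (take_nth (set0, set0)) // /fire_all foldl_rcons.
  have lk : k.*2.+1 < jS by apply: leq_trans jS_ge; rewrite -doubleS leq_double.
  have eN S i : i < jS -> setslot V jS S i = V i by move=> li; rewrite setslotN ?ltn_eqF.
  by rewrite inV // (eN _ k.*2) ?(eN _ k.*2.+1) // ltnW.
Qed.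

Lemma closure_holds s (V : nat -> {set 'I_n}) :
  holds s V -> inputs sg V -> rg s 2 = n -> rg s 3 = size sg -> rg s 5 = ptr n jS ->
  holds (sem closure_cmd s) (setslot V jS (closure_of sg (V jS))).
Proof.
move=> hV inV hn hm h5.
pose I k s' := holds s' (setslot V jS (iter k (fire_all sg) (V jS))).
have := @for_rule I 23 2 (Ins (Const 25 2);; For 24 3 fire_cmd) s.
rewrite hn /I /closure_of card_ord; apply.
- by apply: holds_init; apply: holds_ext hV => j; rewrite setslot_id.
- move=> k s' ltk fr hs; apply: holds_dec.
  have := fire_all_holds hs; rewrite setslotE => H.
  apply: holds_ext (H _ _ _ _); [|exact: inputs_setslot|by rewrite fr..].
  by move=> j; rewrite setslot_same.
Qed.

End ClosureCmd.

Opaque closure_cmd.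

(** * Testing candidates *)

Definition cand_cmd : cmd :=
  zipwith 30 30 6 op_copy;; Ins (Add 41 6 38);; Ins (Const 42 0);; Ins (Write 41 42).

(** Register 40 counts the objections to a candidate. It starts as the membership of [x] in the
    closure; [y_cmd] and [l_cmd] add theirs, and the candidate is accepted if the total is 0. *)
Definition base_cmd : cmd :=
  zipwith 6 6 5 op_copy;; closure_cmd;; Ins (Add 41 5 38);; Ins (Read 40 41).

Definition y_set : cmd := Ins (Add 41 5 39);; Ins (Const 42 1);; Ins (Write 41 42).
(** The truncated difference 1 - [y in C] - [x in S] is 1 exactly when both memberships fail. *)
Definition y_test : cmd :=
  Ins (Add 41 6 39);; Ins (Read 42 41);; Ins (Const 41 1);; Ins (Sub 42 41 42);;
  Ins (Add 41 5 38);; Ins (Read 41 41);; Ins (Sub 42 42 41);; Ins (Add 40 40 42);;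
  inc 39.
Definition y_body : cmd := zipwith 6 6 5 op_copy;; y_set;; closure_cmd;; y_test.
Definition y_cmd : cmd := Ins (Const 39 0);; For 36 2 y_body.

(** Register 21 counts differing positions, so 1 minus it is 1 exactly when the candidate equals
    this member of the list. *)
Definition l_test : cmd :=
  Ins (Const 41 1);; Ins (Sub 41 41 21);; Ins (Add 40 40 41);; Ins (Add 31 31 2).
Definition l_body : cmd := zipwith 6 31 31 op_eq;; l_test.
Definition l_cmd : cmd := copy 31 8;; For 37 4 l_body.

(** [If] acts on nonzero values, hence the test of 1 minus the objections. A later success
    overwrites [F]: a pass keeps one new set. *)
Definition x_record : cmd :=
  Ins (Const 43 1);; Ins (Sub 43 43 40);;
  If 43 (zipwith 6 6 7 op_copy;; Ins (Const 11 1));; inc 38.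
Definition x_body : cmd := cand_cmd;; base_cmd;; y_cmd;; l_cmd;; x_record.
Definition x_cmd : cmd := Ins (Const 38 0);; For 35 2 x_body.
Definition a_body : cmd := x_cmd;; Ins (Add 30 30 2).
Definition search_cmd : cmd :=
  (Ins (Const 11 0);; copy 30 9);; For 34 10 a_body.

Section Test.
Variables (n : nat) (sg : seq (implication 'I_n)).

Notation jS := (size sg).*2.
Notation jC := (size sg).*2.+1.
Notation jF := (size sg).*2.+2.
Notation jL := (size sg).*2.+3.

Record env (N : nat) (s : state) : Prop := Env {
  env_n : rg s 2 = n;
  env_m : rg s 3 = size sg;
  env_N : rg s 4 = N;
  env_S : rg s 5 = ptr n jS;
  env_C : rg s 6 = ptr n jC;
  env_F : rg s 7 = ptr n jF;
  env_L : rg s 8 = ptr n jL;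
  env_W : rg s 9 = ptr n (jL + N)
}.

Lemma env_ext N s s' :
  (forall r, 2 <= r < 10 -> rg s' r = rg s r) -> env N s -> env N s'.
Proof. by move=> e [*]; split; rewrite e. Qed.

Lemma env_sem N c s :
  all (fun r => r \notin writes c) (iota 2 8) -> env N s -> env N (sem c s).
Proof.
move=> /allP H; apply: env_ext => r lr; rewrite frame //; apply: H.
by rewrite mem_iota.
Qed.

Lemma holds_cell s (V : nat -> {set 'I_n}) j (i : 'I_n) :
  holds s V -> mm s (ptr n j + i) = (i \in V j).
Proof. by case=> bm <-; rewrite cellE. Qed.

Lemma holds_write s (V : nat -> {set 'I_n}) j (i : 'I_n) a v :
  holds s V -> rg s a = ptr n j + i -> rg s v <= 1 ->
  holds (sem (Ins (Write a v)) s)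
    (setslot V j (if rg s v == 0 then V j :\ i else i |: V j)).
Proof.
move=> [bm sl] ea ev; split; first exact: bitmem_upd.
by move=> j'; rewrite /= ea slot_upd /setslot !sl.
Qed.

Section Candidate.
Variables (N : nat) (x : 'I_n).

Lemma cand_holds s (V : nat -> {set 'I_n}) ja :
  holds s V -> env N s -> rg s 38 = x -> rg s 30 = ptr n ja ->
  holds (sem cand_cmd s) (setslot V jC (V ja :\ x)).
Proof.
move=> hV ev hx ha; rewrite /cand_cmd 3!sem_seq.
have H := copy_holds hV (env_n ev) (isT : zip_reg 30) (isT : zip_reg 6) ha (env_C ev).
set s1 := sem (zipwith _ _ _ _) s in H *.
have e1 : rg (sem (Ins (Const 42 0)) (sem (Ins (Add 41 6 38)) s1)) 41 = ptr n jC + x.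
  by regs; rewrite /s1 !frame // hx (env_C ev).
have := holds_write (s := sem (Ins (Const 42 0)) (sem (Ins (Add 41 6 38)) s1)) (v := 42) H e1 isT.
rewrite [rg _ _]/= /upd /= setslotE => H2; apply: holds_ext H2 => j.
by rewrite setslot_same.
Qed.

Lemma base_holds s (V : nat -> {set 'I_n}) :
  holds s V -> inputs sg V -> env N s -> rg s 38 = x ->
  let s' := sem base_cmd s in
  holds s' (setslot V jS (closure_of sg (V jC))) /\ rg s' 40 = (x \in closure_of sg (V jC)).
Proof.
move=> hV inV ev hx; rewrite /base_cmd 3!sem_seq.
have H := copy_holds hV (env_n ev) (isT : zip_reg 6) (isT : zip_reg 5) (env_C ev) (env_S ev).
have ev1 : env N (sem (zipwith 6 6 5 op_copy) s) by apply: env_sem.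
have hx1 : rg (sem (zipwith 6 6 5 op_copy) s) 38 = x by rewrite frame.
move: (sem _ s) H ev1 hx1 => s1 H ev1 hx1 {hV ev hx s}.
have inV1 := inputs_setslot (V jC) (leqnn _) inV.
have := closure_holds (leqnn _) H inV1 (env_n ev1) (env_m ev1) (env_S ev1).
have ev2 : env N (sem closure_cmd s1) by apply: env_sem.
have hx2 : rg (sem closure_cmd s1) 38 = x by rewrite frame.
move: (sem _ s1) ev2 hx2 => s2 ev2 hx2 {H ev1 hx1 s1}.
rewrite setslotE => H; split.
  have {}H : holds (sem (Ins (Read 40 41)) (sem (Ins (Add 41 5 38)) s2))
     (setslot (setslot V jS (V jC)) jS (closure_of sg (V jC))) by [].
  by apply: holds_ext H => j; rewrite setslot_same.
by regs; rewrite hx2 (env_S ev2) (holds_cell _ _ H) setslotE.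
Qed.

Lemma y_body_holds s (V : nat -> {set 'I_n}) (y : 'I_n) :
  holds s V -> inputs sg V -> env N s -> rg s 38 = x -> rg s 39 = y ->
  let s' := sem y_body s in
  [/\ holds s' (setslot V jS (closure_of sg (y |: V jC))), rg s' 39 = y.+1 &
    rg s' 40 = rg s 40 + ((y \notin V jC) && (x \notin closure_of sg (y |: V jC)))].
Proof.
move=> hV inV ev hx hy; rewrite /y_body 3!sem_seq.
have H := copy_holds hV (env_n ev) (isT : zip_reg 6) (isT : zip_reg 5) (env_C ev) (env_S ev).
have ev1 : env N (sem (zipwith 6 6 5 op_copy) s) by apply: env_sem.
have hx1 : rg (sem (zipwith 6 6 5 op_copy) s) 38 = x by rewrite frame.
have hy1 : rg (sem (zipwith 6 6 5 op_copy) s) 39 = y by rewrite frame.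
have hb1 : rg (sem (zipwith 6 6 5 op_copy) s) 40 = rg s 40 by rewrite frame.
rewrite -hb1; move: (sem _ s) H ev1 hx1 hy1 {hb1} => s1 H ev1 hx1 hy1 {hV ev hx hy s}.
have {}H : holds (sem y_set s1) (setslot V jS (y |: V jC)).
  rewrite /y_set 2!sem_seq.
  have e1 : rg (sem (Ins (Const 42 1)) (sem (Ins (Add 41 5 39)) s1)) 41 = ptr n jS + y.
    by regs; rewrite hy1 (env_S ev1).
  have := holds_write (s := sem (Ins (Const 42 1)) (sem (Ins (Add 41 5 39)) s1)) (v := 42) H e1 isT.
  rewrite [rg _ _]/= /upd /= setslotE => H2; apply: holds_ext H2 => j.
  by rewrite setslot_same.
have inV1 := inputs_setslot (y |: V jC) (leqnn _) inV.
have ev2 : env N (sem y_set s1) by apply: env_sem.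
have := closure_holds (leqnn _) H inV1 (env_n ev2) (env_m ev2) (env_S ev2).
rewrite setslotE => {}H.
have ev3 : env N (sem closure_cmd (sem y_set s1)) by apply: env_sem.
have hx3 : rg (sem closure_cmd (sem y_set s1)) 38 = x by rewrite !frame.
have hy3 : rg (sem closure_cmd (sem y_set s1)) 39 = y by rewrite !frame.
have hb3 : rg (sem closure_cmd (sem y_set s1)) 40 = rg s1 40 by rewrite !frame.
rewrite -hb3; move: (sem closure_cmd _) H ev3 hx3 hy3 {hb3} => s3 H ev3 hx3 hy3.
split.
- have {}H : holds (sem y_test s3)
    (setslot (setslot V jS (y |: V jC)) jS (closure_of sg (y |: V jC))) by [].
  by apply: holds_ext H => j; rewrite setslot_same.
- by regs; rewrite hy3 addn1.
- regs; rewrite hx3 hy3 (env_S ev3) (env_C ev3) !(holds_cell _ _ H) setslotE.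
  rewrite !setslotN ?(gtn_eqF (ltnSn _)) //; congr (_ + _).
  by case: (y \in V jC); case: (x \in _).
Qed.

Lemma y_cmd_holds s (V : nat -> {set 'I_n}) :
  holds s V -> inputs sg V -> env N s -> rg s 38 = x ->
  let s' := sem y_cmd s in
  (exists S, holds s' (setslot V jS S)) /\
  (rg s' 40 = 0 <->
    rg s 40 = 0 /\ forall y, y \in V jC \/ x \in closure_of sg (y |: V jC)).
Proof.
move=> hV inV ev hx; rewrite /y_cmd sem_seq.
have hV1 : holds (sem (Ins (Const 39 0)) s) V by [].
have ev1 : env N (sem (Ins (Const 39 0)) s) by apply: env_sem.
have hx1 : rg (sem (Ins (Const 39 0)) s) 38 = x by [].
have hy1 : rg (sem (Ins (Const 39 0)) s) 39 = 0 by [].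
have hb1 : rg (sem (Ins (Const 39 0)) s) 40 = rg s 40 by [].
rewrite -hb1; move: (sem (Ins _) s) hV1 ev1 hx1 hy1 {hb1} => {hV ev hx}s hV ev hx hy.
pose I k s' := [/\ exists S, holds s' (setslot V jS S), rg s' 39 = k &
  rg s' 40 = 0 <-> rg s 40 = 0 /\
    forall y : 'I_n, y < k -> y \in V jC \/ x \in closure_of sg (y |: V jC)].
have := @for_rule I 36 2 y_body s; rewrite (env_n ev) => /(_ _ _)[].
- split=> //.
    by exists (V jS); apply: holds_init; apply: holds_ext hV => j; rewrite setslot_id.
  by rewrite for_init_rg //; split=> [|[]].
- move=> k s' ltk fr [[S hS] hy' hb'].
  (* Registers 2 to 9 are checked one by one against the registers that the loop writes. *)
  have evs : env N s' by apply: env_ext ev => r lr; apply: fr; move: r lr; do 10!case=> //.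
  have inS := inputs_setslot S (leqnn _) inV.
  have hx' : rg s' 38 = x by rewrite fr.
  have [H e39 e40] := y_body_holds (y := Ordinal ltk) hS inS evs hx' hy'.
  split.
  + exists (closure_of sg (Ordinal ltk |: V jC)); apply: holds_dec.
    apply: holds_ext H => j; rewrite setslot_same.
    by rewrite [setslot V jS S jC]setslotN ?gtn_eqF.
  + by rewrite for_dec_rg.
  + rewrite for_dec_rg // e40 [setslot V jS S jC]setslotN ?gtn_eqF //.
    set b := _ && _.
    have bP : b = false <-> Ordinal ltk \in V jC \/ x \in closure_of sg (Ordinal ltk |: V jC).
      by rewrite /b; case: (_ \in V jC); case: (x \in _) => /=; split=> //; auto; case.
    split.
    * move/eqP; rewrite addn_eq0 => /andP[/eqP/hb'[b0 H'] b00]; split=> // y.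
      rewrite ltnS leq_eqVlt => /orP[/eqP e|]; last exact: H'.
      by rewrite (_ : y = Ordinal ltk) //; [apply/bP; case: (b) b00|apply: val_inj].
    * case=> b0 H'; have -> : b = false by apply/bP/H'.
      by rewrite addn0; apply/hb'; split=> // y lty; apply: H'; apply: ltnW.
- move=> HS _ [h1 h2]; split=> //; split=> [/h1[b0 H]|[b0 H]].
    by split=> // y; apply: H.
  by apply: h2; split.
Qed.

Lemma l_cmd_holds s (V : nat -> {set 'I_n}) :
  holds s V -> env N s ->
  let s' := sem l_cmd s in
  holds s' V /\
  (rg s' 40 = 0 <-> rg s 40 = 0 /\ forall j, j < N -> V (jL + j) <> V jC).
Proof.
move=> hV ev; rewrite /l_cmd sem_seq.
have hV1 : holds (sem (copy 31 8) s) V by [].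
have ev1 : env N (sem (copy 31 8) s) by apply: env_sem.
have hp1 : rg (sem (copy 31 8) s) 31 = ptr n jL by regs; rewrite add0n (env_L ev).
have hb1 : rg (sem (copy 31 8) s) 40 = rg s 40 by [].
rewrite -hb1; move: (sem (copy _ _) s) hV1 ev1 hp1 {hb1} => {hV ev}s hV ev hp.
pose I k s' := [/\ holds s' V, rg s' 31 = ptr n (jL + k) &
  rg s' 40 = 0 <-> rg s 40 = 0 /\ forall j, j < k -> V (jL + j) <> V jC].
have := @for_rule I 37 4 l_body s; rewrite (env_N ev) => /(_ _ _)[] //.
- by split; rewrite ?addn0 // for_init_rg //; split=> [|[]].
- move=> k s' ltk fr [hS hp' hb'].
  have evs : env N s' by apply: env_ext ev => r lr; apply: fr; move: r lr; do 10!case=> //.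
  have [H e21] := eq_holds hS (env_n evs) (isT : zip_reg 6) (isT : zip_reg 31) (env_C evs) hp'.
  have f31 : rg (sem (zipwith 6 31 31 op_eq) s') 31 = ptr n (jL + k) by rewrite frame.
  have f40 : rg (sem (zipwith 6 31 31 op_eq) s') 40 = rg s' 40 by rewrite frame.
  have f2 : rg (sem (zipwith 6 31 31 op_eq) s') 2 = n by rewrite frame // (env_n evs).
  rewrite /I /for_body /l_body !for_dec_rg // sem_seq.
  move: (sem _ s') H e21 f31 f40 f2 => s1 H e21 f31 f40 f2; split=> //.
    by regs; rewrite f31 f2 ptrS addnS.
  regs; rewrite f40; split.
  * move/eqP; rewrite addn_eq0 => /andP[/eqP/hb'[b0 H'] b00]; split=> // j.
    rewrite ltnS leq_eqVlt => /orP[/eqP ->|]; last exact: H'.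
    by move=> e; move: e21 b00; rewrite e eqxx => /eqP->.
  * case=> b0 H'; have /eqP -> : rg s' 40 == 0.
      by apply/eqP/hb'; split=> // j ltj; apply: H'; apply: ltnW.
    have : rg s1 21 != 0 by rewrite e21 eq_sym; apply/eqP; apply: H'.
    by case: (rg s1 21).
Qed.

End Candidate.
End Test.

Opaque cand_cmd base_cmd y_cmd l_cmd.

(** * Search through all intersections and all elements *)

Section Search.
Variables (n : nat) (sg : seq (implication 'I_n)).

Notation jS := (size sg).*2.
Notation jC := (size sg).*2.+1.
Notation jF := (size sg).*2.+2.
Notation jL := (size sg).*2.+3.
Variables (Sigma : {set implication 'I_n}) (N : nat).
Hypothesis sSigma : sg =i Sigma.
Implicit Types (V : nat -> {set 'I_n}).

(** The tests may overwrite [S], [C] and [F]; the input, the list and the family of intersections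
    must survive them. *)
Definition outside_scratch V V' : Prop :=
  forall j, ~~ (jS <= j < jL) -> V' j = V j.

Definition fresh V (C : {set 'I_n}) : Prop :=
  forall j, j < N -> V (jL + j) <> C.

Definition new_irr V (x : 'I_n) (C : {set 'I_n}) : Prop :=
  C \in irr_at Sigma x /\ fresh V C.

Lemma outside_scratch_trans V V' V'' :
  outside_scratch V V' -> outside_scratch V' V'' -> outside_scratch V V''.
Proof. by move=> h h' j hj; rewrite h' // h. Qed.

Lemma outside_scratch_setslot V j S :
  jS <= j < jL -> outside_scratch V (setslot V j S).
Proof. by move=> lj j' hj'; rewrite setslotN //; apply: contra hj' => /eqP->. Qed.

Lemma outside_scratch_inputs V V' : outside_scratch V V' -> inputs sg V -> inputs sg V'.
Proof. by move=> h inV r lr; rewrite inV // !h //; lia. Qed.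

Lemma fresh_outside V V' C : outside_scratch V V' -> fresh V' C <-> fresh V C.
Proof.
by move=> h; split=> H j lj; move: (H j lj); rewrite h //; lia.
Qed.

Lemma x_record_new s V (x : 'I_n) :
  holds s V -> env sg N s -> rg s 38 = x -> rg s 40 = 0 ->
  let s' := sem x_record s in
  [/\ holds s' (setslot V jF (V jC)), rg s' 38 = x.+1 & rg s' 11 = 1].
Proof.
move=> hV ev hx b0; rewrite /x_record 3!sem_seq.
have ev5 : env sg N (sem (Ins (Sub 43 43 40)) (sem (Ins (Const 43 1)) s)).
  by do 2!apply: env_sem => //.
have h5 : holds (sem (Ins (Sub 43 43 40)) (sem (Ins (Const 43 1)) s)) V.
  by do 2!apply: holds_ins => //.
have f5 : rg (sem (Ins (Sub 43 43 40)) (sem (Ins (Const 43 1)) s)) 38 = x.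
  by rewrite !frame.
have e5 : rg (sem (Ins (Sub 43 43 40)) (sem (Ins (Const 43 1)) s)) 43 != 0.
  by regs; rewrite b0.
move: (sem (Ins _) _) ev5 h5 f5 e5 => s5 ev5 h5 f5 e5; rewrite sem_if_true // sem_seq.
have := copy_holds h5 (env_n ev5) (isT : zip_reg 6) (isT : zip_reg 7) (env_C ev5) (env_F ev5).
have : rg (sem (zipwith 6 6 7 op_copy) s5) 38 = x by rewrite frame.
move: (sem (zipwith _ _ _ _) _) => s6 f6 h6; split.
- by rewrite /inc sem_seq; do 3!apply: holds_ins => //.
- by regs; rewrite f6 addn1.
- by [].
Qed.

Lemma x_record_old s V (x : 'I_n) :
  holds s V -> rg s 38 = x -> rg s 40 != 0 ->
  let s' := sem x_record s in
  [/\ holds s' V, rg s' 38 = x.+1 & rg s' 11 = rg s 11].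
Proof.
move=> hV hx b0; rewrite /x_record 3!sem_seq sem_if_false; last first.
  by regs; case: (rg s 40) b0.
split.
- by rewrite /inc sem_seq; do 4!apply: holds_ins => //.
- by regs; rewrite hx addn1.
- by [].
Qed.

Opaque x_record.

Lemma x_body_holds s V (x : 'I_n) ja (C := V ja :\ x) :
  holds s V -> inputs sg V -> env sg N s -> rg s 38 = x ->
  rg s 30 = ptr n ja ->
  let s' := sem x_body s in
  exists V', [/\ holds s' V', outside_scratch V V', rg s' 38 = x.+1 &
    [/\ new_irr V x C, rg s' 11 = 1 & V' jF = C] \/
    [/\ ~ new_irr V x C, rg s' 11 = rg s 11 & V' jF = V jF]].
Proof.
move=> hV inV ev hx ha; rewrite /x_body 4!sem_seq.
have h1 := cand_holds hV ev hx ha; rewrite -/C in h1.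
have o1 : outside_scratch V (setslot V jC C) by apply: outside_scratch_setslot; lia.
have in1 := outside_scratch_inputs o1 inV.
have ev1 : env sg N (sem cand_cmd s) by apply: env_sem.
have hx1 : rg (sem cand_cmd s) 38 = x by rewrite frame.
have [h2 b2] := base_holds h1 in1 ev1 hx1; rewrite setslotE in h2 b2.
set s2 := sem base_cmd _ in h2 b2 *.
have o2 := outside_scratch_setslot (setslot V jC C) (closure_of sg C) (_ : jS <= jS < jL).
have {}o2 := outside_scratch_trans o1 (o2 ltac:(lia)).
have in2 := outside_scratch_inputs o2 inV.
have ev2 : env sg N s2 by apply: env_sem.
have hx2 : rg s2 38 = x by rewrite /s2 !frame.
have [[S h3] b3] := y_cmd_holds h2 in2 ev2 hx2.
have e3 : setslot (setslot V jC C) jS (closure_of sg C) jC = C.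
  by rewrite setslotN ?setslotE // gtn_eqF.
rewrite e3 in b3; set s3 := sem y_cmd _ in h3 b3 *.
have ev3 : env sg N s3 by apply: env_sem.
have [h4 b4] := l_cmd_holds h3 ev3; set s4 := sem l_cmd _ in h4 b4 *.
set V4 := setslot (setslot _ _ _) _ _ in h4 b4.
have o4 : outside_scratch V V4.
  apply: outside_scratch_trans o2 _; apply: outside_scratch_setslot; lia.
have e4 : V4 jC = C by rewrite /V4 setslotN ?e3 // gtn_eqF.
have e4F : V4 jF = V jF by rewrite /V4 !setslotN // gtn_eqF // ltnW.
have ev4 : env sg N s4 by apply: env_sem.
have hx4 : rg s4 38 = x by rewrite /s4 /s3 !frame.
have hf4 : rg s4 11 = rg s 11 by rewrite /s4 /s3 /s2 !frame.
have badP : rg s4 40 = 0 <-> new_irr V x C.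
  split.
    move/b4 => [/b3[e40 H] fr]; split; last by apply/(fresh_outside _ o4); rewrite -e4.
    by apply/(mem_irr_at sSigma); split=> //; move: e40; rewrite b2; case: (x \in _).
  case=> [/(mem_irr_at sSigma)[xC H] fr]; apply/b4; split.
    by apply/b3; split=> //; rewrite b2 (negbTE xC).
  by rewrite e4; apply/(fresh_outside _ o4).
clearbody s4; have [b0|b0] := eqVneq (rg s4 40) 0.
- have [h5 e38 e11] := x_record_new h4 ev4 hx4 b0.
  exists (setslot V4 jF (V4 jC)); split=> //.
    apply: outside_scratch_trans o4 _; apply: outside_scratch_setslot; lia.
  by left; split=> //; [apply/badP|rewrite setslotE].
- have [h5 e38 e11] := x_record_old h4 hx4 b0.
  exists V4; split=> //; right; split=> //; last by rewrite e11.
  by move/badP/eqP; rewrite (negbTE b0).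
Qed.

Opaque x_body.

Definition found_ok V s : Prop :=
  rg s 11 = 0 \/ [/\ rg s 11 = 1, V jF \in irr Sigma & fresh V (V jF)].

(** [jL <= ja] keeps the intersection out of the slots that the tests overwrite, so every [x] is
    tried on the same set. The tests never reset the flag: if it is 0 at the end, no candidate was
    new. *)
Lemma x_cmd_holds s V ja : jL <= ja ->
  holds s V -> inputs sg V -> env sg N s -> rg s 30 = ptr n ja -> found_ok V s ->
  let s' := sem x_cmd s in
  exists V', [/\ holds s' V', outside_scratch V V', found_ok V' s' &
    rg s' 11 = 0 -> rg s 11 = 0 /\ forall x, ~ new_irr V x (V ja :\ x)].
Proof.
move=> lja hV inV ev ha ok; rewrite /x_cmd sem_seq.
have hV1 : holds (sem (Ins (Const 38 0)) s) V by [].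
have ev1 : env sg N (sem (Ins (Const 38 0)) s) by apply: env_sem.
have ha1 : rg (sem (Ins (Const 38 0)) s) 30 = ptr n ja by [].
have hx1 : rg (sem (Ins (Const 38 0)) s) 38 = 0 by [].
have ok1 : found_ok V (sem (Ins (Const 38 0)) s) by [].
have hf1 : rg (sem (Ins (Const 38 0)) s) 11 = rg s 11 by [].
rewrite -hf1; move: (sem (Ins _) s) hV1 ev1 ha1 hx1 ok1 {hf1} => {hV ev ha ok}s hV ev ha hx ok.
pose I k s' := exists V', [/\ holds s' V', outside_scratch V V', found_ok V' s',
    rg s' 38 = k &
    rg s' 11 = 0 -> rg s 11 = 0 /\ forall x : 'I_n, x < k -> ~ new_irr V x (V ja :\ x)].
have := @for_rule I 35 2 x_body s; rewrite (env_n ev) => /(_ _ _)[].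
- by exists V; split.
- move=> k s' ltk fr [V1 [h1 o1 ok1 hk1 z1]].
  have evs : env sg N s' by apply: env_ext ev => r lr; apply: fr; move: r lr; do 10!case=> //.
  have ha' : rg s' 30 = ptr n ja by rewrite fr.
  have in1 := outside_scratch_inputs o1 inV.
  have [V2 [h2 o2 hk2 H]] := x_body_holds (x := Ordinal ltk) h1 in1 evs hk1 ha'.
  have e1 : V1 ja = V ja by apply: o1; lia.
  rewrite e1 in H.
  have o12 := outside_scratch_trans o1 o2.
  have newE C : new_irr V1 (Ordinal ltk) C <-> new_irr V (Ordinal ltk) C.
    by split=> -[? /(fresh_outside _ o1)].
  rewrite /for_body; move: (sem x_body s') h2 hk2 H => s2 h2 hk2 H.
  have d11 : rg (for_dec 35 s2) 11 = rg s2 11 by apply: for_dec_rg.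
  have d38 : rg (for_dec 35 s2) 38 = rg s2 38 by apply: for_dec_rg.
  exists V2; rewrite /found_ok d11 d38.
  split; [exact: holds_dec|exact: o12| |exact: hk2|].
  + case: H => -[nw -> ->].
      right; split=> //; first by apply/bigcupP; exists (Ordinal ltk) => //; case: nw.
      by apply/(fresh_outside _ o2); case: nw.
    case: ok1 => [|[]]; first by left.
    by right; split=> //; apply/(fresh_outside _ o2).
  + case: H => -[nw -> _] // /z1[z H]; split=> // x; rewrite ltnS leq_eqVlt.
    case/orP=> [/eqP e|]; last exact: H.
    by rewrite (_ : x = Ordinal ltk); [move/newE|apply: val_inj].
- move=> V' [h o ok' _ z]; exists V'; split=> // /z[z0 H]; split=> // x.
  exact: H.
Qed.

Opaque x_cmd.

Lemma search_holds s V K :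
  holds s V -> inputs sg V -> env sg N s -> rg s 10 = K ->
  let s' := sem search_cmd s in
  exists V', [/\ holds s' V', outside_scratch V V', found_ok V' s' &
    rg s' 11 = 0 -> forall a, a < K -> forall x, ~ new_irr V x (V (jL + N + a) :\ x)].
Proof.
move=> hV inV ev hK; rewrite /search_cmd sem_seq.
have hV1 : holds (sem (Ins (Const 11 0);; copy 30 9) s) V by [].
have ev1 : env sg N (sem (Ins (Const 11 0);; copy 30 9) s) by apply: env_sem.
have ha1 : rg (sem (Ins (Const 11 0);; copy 30 9) s) 30 = ptr n (jL + N).
  by regs; rewrite add0n (env_W ev).
have hf1 : rg (sem (Ins (Const 11 0);; copy 30 9) s) 11 = 0 by [].
have hK1 : rg (sem (Ins (Const 11 0);; copy 30 9) s) 10 = K by [].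
move: (sem (_;; _) s) hV1 ev1 ha1 hf1 hK1 => {hV ev hK}s hV ev ha hf hK.
pose I k s' := exists V', [/\ holds s' V', outside_scratch V V', found_ok V' s',
    rg s' 30 = ptr n (jL + N + k) &
    rg s' 11 = 0 -> forall a, a < k -> forall x, ~ new_irr V x (V (jL + N + a) :\ x)].
have := @for_rule I 34 10 a_body s; rewrite hK => /(_ _ _)[].
- by exists V; split=> //; rewrite ?addn0 //; left.
- move=> k s' ltk fr [V1 [h1 o1 ok1 ha' z1]].
  have evs : env sg N s' by apply: env_ext ev => r lr; apply: fr; move: r lr; do 10!case=> //.
  have in1 := outside_scratch_inputs o1 inV.
  have lj : jL <= jL + N + k by rewrite -addnA leq_addr.
  have [V2 [h2 o2 ok2 H]] := x_cmd_holds lj h1 in1 evs ha' ok1.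
  have e1 : V1 (jL + N + k) = V (jL + N + k) by apply: o1; lia.
  rewrite e1 in H.
  rewrite /for_body /a_body sem_seq.
  have f30 : rg (sem x_cmd s') 30 = ptr n (jL + N + k) by rewrite frame.
  have f2 : rg (sem x_cmd s') 2 = n by rewrite frame // (env_n evs).
  move: (sem x_cmd s') h2 ok2 H f30 f2 => s2 h2 ok2 H f30 f2.
  have d11 : rg (for_dec 34 (sem (Ins (Add 30 30 2)) s2)) 11 = rg s2 11.
    by rewrite for_dec_rg ?frame.
  have d30 : rg (for_dec 34 (sem (Ins (Add 30 30 2)) s2)) 30 = ptr n (jL + N + k.+1).
    by rewrite /= /upd /= f30 f2 ptrS addnS.
  exists V2; rewrite /found_ok d11 d30; split.
  + by apply: holds_dec; apply: holds_ins.
  + exact: outside_scratch_trans o1 o2.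
  + exact: ok2.
  + by [].
  + move=> /H[/z1 z H'] a; rewrite ltnS leq_eqVlt.
    case/orP=> [/eqP-> x [nw /(fresh_outside _ o1) nf]|]; last exact: z.
    by apply: (H' x).
- by move=> V' [h o ok' _ z]; exists V'.
Qed.

End Search.

Opaque search_cmd.

(** * Intersections of the sets found *)

Definition cap_body : cmd :=
  zipwith 30 31 32 op_and;; Ins (Add 32 32 2);; Ins (Add 31 31 2);; inc 33.
Definition cap_row : cmd := copy 31 8;; For 29 4 cap_body;; Ins (Add 30 30 2).
Definition grow_init : cmd := copy 30 9;; copy 33 10.
(** Keeping the K old members and adding their intersections with the N members of the list makes
    K(N + 1). Register 33 counts them while register 10 still bounds the loop over the old ones. *)
Definition grow_cmd : cmd := grow_init;; For 28 10 cap_row;; copy 10 33.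
Definition build_init d : cmd :=
  zipwith 9 9 9 op_one;; Ins (Const 10 1);; Ins (Add 32 9 2);; Ins (Const 12 d).
Definition build_cmd d : cmd := build_init d;; For 27 12 grow_cmd.

Section Build.
Variables (n : nat) (sg : seq (implication 'I_n)) (N : nat).
Implicit Types (V : nat -> {set 'I_n}).

Notation jL := (size sg).*2.+3.
Notation jW := (jL + N).

Lemma cap_body_holds s V ja jb e :
  holds s V -> rg s 2 = n ->
  rg s 30 = ptr n ja -> rg s 31 = ptr n jb -> rg s 32 = ptr n e ->
  let s' := sem cap_body s in
  [/\ holds s' (setslot V e (V ja :&: V jb)), rg s' 31 = ptr n jb.+1,
    rg s' 32 = ptr n e.+1 & rg s' 33 = (rg s 33).+1].
Proof.
move=> hV hn ha hb he; rewrite /cap_body 3!sem_seq.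
have H := and_holds hV hn (isT : zip_reg 30) (isT : zip_reg 31) (isT : zip_reg 32) ha hb he.
have f2 : rg (sem (zipwith 30 31 32 op_and) s) 2 = n by rewrite frame.
have f31 : rg (sem (zipwith 30 31 32 op_and) s) 31 = ptr n jb by rewrite frame.
have f32 : rg (sem (zipwith 30 31 32 op_and) s) 32 = ptr n e by rewrite frame.
have f33 : rg (sem (zipwith 30 31 32 op_and) s) 33 = rg s 33 by rewrite frame.
move: (sem (zipwith _ _ _ _) s) H f2 f31 f32 f33 => s1 H f2 f31 f32 f33; split.
- by rewrite /inc sem_seq; do 4!apply: holds_ins => //.
- by regs; rewrite f31 f2 ptrS.
- by regs; rewrite f32 f2 ptrS.
- by regs; rewrite f33 addn1.
Qed.

Opaque cap_body.

(** The new sets are written from slot [e] on: [ja < e] and [jW <= e] keep them off both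
    operands. *)
Lemma cap_row_holds s V ja e :
  holds s V -> env sg N s -> ja < e -> jW <= e ->
  rg s 30 = ptr n ja -> rg s 32 = ptr n e ->
  let s' := sem cap_row s in
  exists V', [/\ holds s' V', forall j, j < e -> V' j = V j,
    forall b, b < N -> V' (e + b) = V ja :&: V (jL + b),
    rg s' 30 = ptr n ja.+1 & rg s' 32 = ptr n (e + N) /\ rg s' 33 = rg s 33 + N].
Proof.
move=> hV ev lja le ha he; rewrite /cap_row 2!sem_seq.
have h1 : holds (sem (copy 31 8) s) V by rewrite /copy sem_seq; do 2!apply: holds_ins => //.
have ev1 : env sg N (sem (copy 31 8) s) by apply: env_sem.
have f30 : rg (sem (copy 31 8) s) 30 = ptr n ja by rewrite frame.
have f31 : rg (sem (copy 31 8) s) 31 = ptr n jL by regs; rewrite (env_L ev).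
have f32 : rg (sem (copy 31 8) s) 32 = ptr n e by rewrite frame.
have f33 : rg (sem (copy 31 8) s) 33 = rg s 33 by rewrite frame.
rewrite -f33; move: (sem (copy _ _) s) h1 ev1 f30 f31 f32 {f33}.
move=> {hV ev ha he}s hV ev ha hb he.
pose I k s' := exists V', [/\ holds s' V', forall j, j < e -> V' j = V j,
    forall b, b < k -> V' (e + b) = V ja :&: V (jL + b),
    rg s' 31 = ptr n (jL + k) & rg s' 32 = ptr n (e + k) /\ rg s' 33 = rg s 33 + k].
have := @for_rule I 29 4 cap_body s; rewrite (env_N ev) => /(_ _ _)[].
- by exists V; rewrite !addn0; split.
- move=> k s' ltk fr [V1 [h1 lo hi g31 [g32 g33]]].
  have g2 : rg s' 2 = n by rewrite fr // (env_n ev).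
  have g30 : rg s' 30 = ptr n ja by rewrite fr.
  have [h2 k31 k32 k33] := cap_body_holds h1 g2 g30 g31 g32.
  rewrite /for_body; move: (sem cap_body s') h2 k31 k32 k33 => s2 h2 k31 k32 k33.
  exists (setslot V1 (e + k) (V1 ja :&: V1 (jL + k))); split.
  + exact: holds_dec.
  + move=> j lj; rewrite setslotN ?lo //; lia.
  + move=> b; rewrite ltnS leq_eqVlt => /orP[/eqP->|lb].
      by rewrite setslotE !lo //; clear -le ltk; lia.
    by rewrite setslotN ?hi //; clear -lb; lia.
  + by rewrite for_dec_rg // k31 addnS.
  + by rewrite !for_dec_rg // k32 k33 g33 !addnS.
- move=> V' [h lo hi _ [g32 g33]].
  have f2 : rg (sem (For 29 4 cap_body) s) 2 = n by rewrite frame // (env_n ev).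
  have f30 : rg (sem (For 29 4 cap_body) s) 30 = ptr n ja by rewrite frame.
  move: (sem (For _ _ _) s) h g32 g33 f2 f30 => s2 h g32 g33 f2 f30.
  exists V'; split; [exact: holds_ins|exact: lo|exact: hi| |].
  + by regs; rewrite f30 f2 ptrS.
  + by rewrite !frame.
Qed.

Opaque cap_row.

Lemma grow_holds s V K :
  holds s V -> env sg N s -> rg s 10 = K -> rg s 32 = ptr n (jW + K) ->
  let s' := sem grow_cmd s in
  exists V', [/\ holds s' V', forall j, j < jW + K -> V' j = V j,
    forall a b, a < K -> b < N -> exists2 c, c < K * N.+1 &
      V' (jW + c) = V (jW + a) :&: V (jL + b)
    & rg s' 10 = K * N.+1 /\ rg s' 32 = ptr n (jW + K * N.+1)].
Proof.
move=> hV ev hK he; rewrite /grow_cmd 2!sem_seq.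
have h1 : holds (sem grow_init s) V.
  by rewrite /grow_init /copy !sem_seq; do 4!apply: holds_ins => //.
have ev1 : env sg N (sem grow_init s) by apply: env_sem.
have f10 : rg (sem grow_init s) 10 = K by rewrite frame.
have f30 : rg (sem grow_init s) 30 = ptr n jW by regs; rewrite (env_W ev).
have f32 : rg (sem grow_init s) 32 = ptr n (jW + K) by rewrite frame.
have f33 : rg (sem grow_init s) 33 = K by regs; rewrite hK.
move: (sem grow_init s) h1 ev1 f10 f30 f32 f33.
move=> {hV ev hK he}s hV ev hK ha he hc.
pose I k s' := exists V', [/\ holds s' V', forall j, j < jW + K -> V' j = V j,
    forall a b, a < k -> b < N -> V' (jW + K + a * N + b) = V (jW + a) :&: V (jL + b),
    rg s' 30 = ptr n (jW + k) &
    rg s' 32 = ptr n (jW + K + k * N) /\ rg s' 33 = K + k * N].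
have := @for_rule I 28 10 cap_row s; rewrite hK => /(_ _ _)[].
- by exists V; rewrite !addn0; split.
- move=> k s' ltk fr [V1 [h1 lo hi g30 [g32 g33]]].
  have evs : env sg N s' by apply: env_ext ev => r lr; apply: fr; move: r lr; do 10!case=> //.
  have l1 : jW + k < jW + K + k * N by rewrite ltn_addr // ltn_add2l.
  have l2 : jW <= jW + K + k * N by apply: leq_trans (ltnW l1); apply: leq_addr.
  have [V2 [h2 lo2 hi2 k30 [k32 k33]]] := cap_row_holds h1 evs l1 l2 g30 g32.
  rewrite /for_body; move: (sem cap_row s') h2 k30 k32 k33 => s2 h2 k30 k32 k33.
  exists V2; split.
  + exact: holds_dec.
  + by move=> j lj; rewrite lo2 ?lo // ltn_addr.
  + move=> a b; rewrite ltnS leq_eqVlt => /orP[/eqP->|la] lb.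
      by rewrite hi2 // !lo //; clear -ltk lb; lia.
    have l3 : a * N + b < k * N.
      apply: (@leq_trans (a.+1 * N)); first by rewrite mulSn addnC ltn_add2r.
      by rewrite leq_mul2r la orbT.
    by rewrite lo2 ?hi // -addnA ltn_add2l.
  + by rewrite for_dec_rg // k30 addnS.
  + by rewrite !for_dec_rg // k32 k33 g33 mulSnr !addnA.
- move=> V' [h lo hi _ [g32 g33]].
  move: (sem (For _ _ _) s) h g32 g33 => s2 h g32 g33.
  exists V'; split.
  + by rewrite /copy sem_seq; do 2!apply: holds_ins => //.
  + exact: lo.
  (* The K old members come first, then one row of N intersections for each of them. *)
  + move=> a b la lb; exists (K + a * N + b); last by rewrite -hi // !addnA.
    by clear -la lb; nia.
  + by split; regs; rewrite ?g32 ?g33 mulnS ?addnA.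
Qed.

Definition in_list V : pred {set 'I_n} :=
  fun A => [exists j : 'I_N, V (jL + j) == A].

(** Lists stand for families of at most [t] members: repetitions are harmless, and one more round
    accounts for one more head. *)
Definition covers V (K t : nat) : Prop :=
  forall l, size l <= t -> all (in_list V) l ->
    exists2 c, c < K & V (jW + c) = \bigcap_(A <- l) A.

Definition built V V' t s : Prop :=
  [/\ holds s V', forall j, j < jW -> V' j = V j, covers V' (N.+1 ^ t) t,
    rg s 10 = N.+1 ^ t & rg s 32 = ptr n (jW + N.+1 ^ t)].

(** The empty intersection is the full set, and [N.+1 ^ 0 = 1]. *)
Lemma build_init_built d s V : holds s V -> env sg N s ->
  exists V', built V V' 0 (sem (build_init d) s).
Proof.
move=> hV ev; rewrite /build_init 3!sem_seq.
have H := one_holds hV (env_n ev) (isT : zip_reg 9) (env_W ev).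
have f2 : rg (sem (zipwith 9 9 9 op_one) s) 2 = n by rewrite frame // (env_n ev).
have f9 : rg (sem (zipwith 9 9 9 op_one) s) 9 = ptr n jW by rewrite frame // (env_W ev).
move: (sem (zipwith _ _ _ _) s) H f2 f9 => s1 H f2 f9.
exists (setslot V jW setT); split.
- by do 3!apply: holds_ins => //.
- by move=> j lj; rewrite setslotN // ltn_eqF.
- by move=> [|] // _ _; exists 0; rewrite // addn0 setslotE big_nil.
- by [].
- by regs; rewrite f2 f9 ptrS addn1.
Qed.

(** The head of a list is intersected with the set obtained from its tail in the previous round; the
    empty list is served by an old member, which is kept. *)
Lemma grow_built s V V' t : env sg N s -> built V V' t s ->
  exists V'', built V V'' t.+1 (sem grow_cmd s).
Proof.
move=> ev [h lo cov e10 e32].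
have [V2 [h2 lo2 hi2 [k10 k32]]] := grow_holds h ev e10 e32.
rewrite -expnSr in hi2 k10 k32.
exists V2; split=> //; first by move=> j lj; rewrite lo2 ?lo // ltn_addr.
have inE A : in_list V2 A = in_list V' A.
  apply: eq_existsb => j; rewrite lo2 //; have := ltn_ord j; clear; lia.
have pos := expn_gt0 N.+1 t.
move=> [|A l] sl al.
  have [//|c lc ec] := cov [::] isT; exists c; last by rewrite lo2 ?ltn_add2l.
  by apply: leq_trans lc _; rewrite expnS leq_pmull.
move: al; rewrite /= inE => /andP[/existsP[b /eqP eb] al].
have [||a la ea] := cov l => //; first by rewrite -(eq_all inE).
have [c lc ec] := hi2 a b la (ltn_ord b).
by exists c; rewrite // ec ea big_cons eb setIC.
Qed.

End Build.

Opaque build_init.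

(** * Output, passes and initialization *)

Definition put_body : cmd := Ins (Read 46 45);; Ins (Put 46);; inc 45.
Definition append_cmd : cmd := Ins Emit;; inc 4;; Ins (Add 9 9 2).
(** The list ends where the family of intersections begins: the new set is copied over the first
    member of that family, which the next pass rebuilds. *)
Definition emit_cmd : cmd :=
  zipwith 7 7 9 op_copy;; copy 45 7;; For 44 2 put_body;; append_cmd.
Definition pass_cmd d : cmd := build_cmd d;; search_cmd;; If 11 emit_cmd.

Definition setup_init : cmd :=
  Ins (Const 0 0);; Ins (Read 2 0);; Ins (Const 0 1);; Ins (Read 3 0);; Ins (Const 5 2).
(** The machine does not multiply: the address of [S], 2 plus twice the number of implications times
    [n], is reached by adding [n] twice per implication. *)
Definition setup_body : cmd := Ins (Add 5 5 2);; Ins (Add 5 5 2).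
Definition setup_end : cmd :=
  Ins (Add 6 5 2);; Ins (Add 7 6 2);; Ins (Add 8 7 2);; copy 9 8;; Ins (Const 4 0).
Definition setup_cmd : cmd := setup_init;; For 23 3 setup_body;; setup_end.

Lemma cost_seq c1 c2 s : cost (c1;; c2) s = cost c1 s + cost c2 (sem c1 s).
Proof. by []. Qed.

Lemma cost_for_le k a c s Z T : rg s a <= Z ->
  (forall j, j < rg s a -> cost c (iter j (for_body k c) (for_init k a s)) <= T) ->
  cost (For k a c) s <= 3 + Z * (T + 4).
Proof.
move=> la H; rewrite [cost _ _]/= leq_add2l.
apply: (@leq_trans (\sum_(j < rg s a) (T + 4))).
  by apply: leq_sum => j _; rewrite leq_add2r H.
by rewrite sum_nat_const card_ord leq_mul2r la orbT.
Qed.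

Section Pass.
Variables (n : nat) (sg : seq (implication 'I_n)).
Implicit Types (V : nat -> {set 'I_n}).

Notation jF := (size sg).*2.+2.
Notation jL := (size sg).*2.+3.

Definition small Z s : bool := [&& rg s 2 <= Z, rg s 3 <= Z, rg s 4 <= Z & rg s 10 <= Z].

Lemma cost_le c s Z : small Z s -> all (fun a => a \in [:: 2; 3; 4; 10]) (bounds c) ->
  all (fun a => (a != 0) && (a \notin writes c)) (bounds c) -> wf c ->
  cost c s <= cost_bound c Z.
Proof.
case/and4P=> s2 s3 s4 s10 bc nc wc; apply: cost_boundP => //.
by apply: sub_all bc => r; rewrite !inE => /or4P[]/eqP->.
Qed.

Lemma env_small N s Z : env sg N s -> n <= Z -> size sg <= Z -> N <= Z ->
  rg s 10 <= Z -> small Z s.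
Proof. by move=> ev *; rewrite /small (env_n ev) (env_m ev) (env_N ev); apply/and4P. Qed.

(** [cost_boundP] does not apply to [grow_cmd] as a whole, which writes register 10, the bound of
    its own loop; it applies to the parts before the final copy. *)
Lemma grow_cost s Z : small Z s -> cost grow_cmd s <= cost_bound grow_cmd Z.
Proof.
move=> sm; rewrite /grow_cmd 2!cost_seq /cost_bound -/cost_bound.
apply: leq_add; first exact: cost_le.
apply: leq_add; last by [].
exact: cost_le.
Qed.

Opaque grow_cmd.

(** Result and cost are proved together: register 10 changes from round to round, and only the
    invariant bounds it. *)
Lemma build_holds N d s V Z :
  n <= Z -> size sg <= Z -> N <= Z -> d <= Z -> N.+1 ^ d <= Z -> rg s 10 <= Z ->
  holds s V -> env sg N s ->
  (exists V', built sg N V V' d (sem (build_cmd d) s)) /\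
  cost (build_cmd d) s <= cost_bound (build_cmd d) Z.
Proof.
move=> nZ mZ NZ dZ eZ kZ hV ev.
have sm := env_small ev nZ mZ NZ kZ.
have [V0 b0] := build_init_built d hV ev.
have ev0 : env sg N (sem (build_init d) s) by apply: env_sem.
have hd : rg (sem (build_init d) s) 12 = d by [].
have c0 : cost (build_init d) s <= cost_bound (build_init d) Z by apply: cost_le.
rewrite /build_cmd sem_seq cost_seq [cost_bound _ _]/=.
move: (sem (build_init d) s) b0 ev0 hd => s0 b0 ev0 hd.
pose I t s' := (exists V', built sg N V V' t s') /\ env sg N s'.
have decI k t s' : k \notin [:: 2; 3; 4; 5; 6; 7; 8; 9; 10; 32] -> I t s' -> I t (for_dec k s').
  rewrite !inE !negb_or => nk [[V' [h lo cov e10 e32]] ev'].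
  have f r : r \in [:: 2; 3; 4; 5; 6; 7; 8; 9; 10; 32] -> rg (for_dec k s') r = rg s' r.
    move=> rr; rewrite for_dec_rg // !inE negb_or; apply/andP; split.
      by apply: contraL rr => /eqP->.
    by apply: contraL rr => /eqP->; rewrite !inE !negb_or.
  split; last by apply: env_ext ev' => r lr; apply: f; move: r lr; do 10!case=> //.
  by exists V'; split; rewrite ?f //; apply: holds_dec.
have := @for_ind I 27 12 grow_cmd s0; rewrite hd => /(_ _ _) H.
have {}H : forall j, j <= d -> I j (iter j (for_body 27 grow_cmd) (for_init 27 12 s0)).
  apply: H.
  - split; last by apply: env_ext ev0 => r lr; apply: for_init_rg; move: r lr; do 10!case=> //.
    by exists V0; case: b0 => *; split=> //; rewrite for_init_rg.
  - move=> t s' lt _ [[V' bV] evs]; apply: decI => //.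
    by split; [apply: grow_built bV|apply: env_sem].
split; first by rewrite sem_for hd; case: (H d (leqnn d)).
apply: leq_add => //; rewrite -[X in X <= _]/(cost (For 27 12 grow_cmd) s0).
apply: cost_for_le; rewrite hd // => j lj; apply: grow_cost.
have [[V' [_ _ _ e10 _]] evj] := H j (ltnW lj); apply: env_small evj _ _ _ _ => //.
by rewrite e10; apply: leq_trans eZ; rewrite leq_pexp2l // ltnW.
Qed.

Lemma put_body_holds s V (i : 'I_n) :
  holds s V -> rg s 45 = ptr n jF + i ->
  let s' := sem put_body s in
  [/\ holds s' V, rg s' 45 = ptr n jF + i.+1,
    pd s' = rcons (pd s) (i \in V jF) & ot s' = ot s].
Proof.
move=> hV e; split.
- by rewrite /put_body /inc 3!sem_seq; do 4!apply: holds_ins => //.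
- by regs; rewrite e addn1 addnS.
- by regs; rewrite e (holds_cell _ _ hV).
- by [].
Qed.

Opaque put_body.

Lemma emit_holds N s V :
  holds s V -> env sg N s -> pd s = [::] ->
  let s' := sem emit_cmd s in
  [/\ holds s' (setslot V (jL + N) (V jF)), env sg N.+1 s', pd s' = [::]
    & ot s' = rcons (ot s) (bits (V jF))].
Proof.
move=> hV ev hp; rewrite /emit_cmd 3!sem_seq.
have H := copy_holds hV (env_n ev) (isT : zip_reg 7) (isT : zip_reg 9) (env_F ev) (env_W ev).
have ev1 : env sg N (sem (zipwith 7 7 9 op_copy) s) by apply: env_sem.
have [p1 o1] := @frame_out (zipwith 7 7 9 op_copy) s isT.
rewrite hp in p1; rewrite -{}o1.
move: (sem (zipwith _ _ _ _) s) H ev1 p1 => s1 H ev1 p1.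
set V1 := setslot _ _ _ in H *.
have -> : V jF = V1 jF by rewrite /V1 setslotN // ltn_eqF // leq_addr.
have h2 : holds (sem (copy 45 7) s1) V1.
  by rewrite /copy sem_seq; do 2!apply: holds_ins => //.
have ev2 : env sg N (sem (copy 45 7) s1) by apply: env_sem.
have e45 : rg (sem (copy 45 7) s1) 45 = ptr n jF by regs; rewrite (env_F ev1).
have p2 : pd (sem (copy 45 7) s1) = [::] by [].
have o2 : ot (sem (copy 45 7) s1) = ot s1 by [].
rewrite -{}o2; move: (sem (copy _ _) s1) h2 ev2 e45 p2 => s2 h2 ev2 e45 p2 {H ev1 p1 s1}.
pose I k s' := [/\ holds s' V1, rg s' 45 = ptr n jF + k,
   pd s' = [seq nat_of_bool (i \in V1 jF) | i <- take k (enum 'I_n)] & ot s' = ot s2].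
have := @for_rule I 44 2 put_body s2; rewrite (env_n ev2) => /(_ _ _)[].
- by split; rewrite ?addn0 ?take0.
- move=> k s' ltk fr [hk ek pk ok].
  have [h3 e3 p3 o3] := put_body_holds (i := Ordinal ltk) hk ek.
  rewrite /for_body; move: (sem put_body s') h3 e3 p3 o3 => s3 h3 e3 p3 o3; split.
  + exact: holds_dec.
  + by rewrite for_dec_rg.
  + rewrite -[pd _]/(pd s3) p3 pk (take_nth (Ordinal ltk)) ?size_enum_ord //.
    by rewrite map_rcons (_ : nth _ _ _ = Ordinal ltk) //; apply: val_inj; rewrite /= nth_enum_ord.
  + by rewrite -[ot _]/(ot s3) o3.
- move=> h3 _; rewrite take_oversize ?size_enum_ord // => p3 o3.
  have ev3 : env sg N (sem (For 44 2 put_body) s2) by apply: env_sem.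
  move: (sem (For _ _ _) s2) h3 ev3 p3 o3 => s3 h3 ev3 p3 o3; split.
  + by rewrite /append_cmd /inc 3!sem_seq; do 4!apply: holds_ins => //.
  + case: ev3 => *; split=> //; regs; first lia.
    by rewrite addnS -ptrS; congr (_ + _).
  + by [].
  + by regs; rewrite o3 p3.
Qed.

End Pass.

Opaque build_cmd emit_cmd.

(** * Correctness and cost of one pass *)

Section Enumeration.
Variables (n : nat) (sg : seq (implication 'I_n)) (Sigma : {set implication 'I_n}).
Variable d : nat.
Hypothesis sSigma : sg =i Sigma.
Hypothesis acyclicSigma : acyclic Sigma.
Hypothesis dimSigma : forall x, dual_dimension (premises Sigma x) <= d.
Implicit Types (V : nat -> {set 'I_n}).

Notation jF := (size sg).*2.+2.
Notation jL := (size sg).*2.+3.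

Definition found_list V N : seq {set 'I_n} := mkseq (fun j => V (jL + j)) N.

Lemma eq_found_list V V' N : (forall j, j < jL + N -> jL <= j -> V' j = V j) ->
  found_list V' N = found_list V N.
Proof.
move=> H; apply/eq_in_map => j; rewrite mem_iota add0n => /= lj.
by apply: H; rewrite ?ltn_add2l // leq_addr.
Qed.

Definition listing (l : seq {set 'I_n}) s : Prop :=
  [/\ pd s = [::], ot s = map (@bits n) l, uniq l & {subset l <= irr Sigma}].

(** Register 10 is left over from the previous pass; its bound is what the cost estimate of the next
    pass requires at the start. *)
Definition ready N s : Prop := exists V,
  [/\ holds s V, inputs sg V, env sg N s, rg s 10 <= N.+1 ^ d
    & listing (found_list V N) s].

Definition finished N s : Prop := exists l,
  [/\ size l = N, listing l s & {subset irr Sigma <= l}].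

Lemma pass_ready N s Z :
  n <= Z -> size sg <= Z -> N <= Z -> d <= Z -> N.+1 ^ d <= Z -> ready N s ->
  let s' := sem (pass_cmd d) s in
  cost (pass_cmd d) s <= cost_bound (pass_cmd d) Z /\
  (rg s' 11 = 0 /\ finished N s' \/ rg s' 11 <> 0 /\ ready N.+1 s').
Proof.
move=> nZ mZ NZ dZ eZ [V [hV inV ev k10 [pV oV uV sV]]].
have [[V1 [h1 lo1 cov1 e10 _]] c1] :=
  build_holds nZ mZ NZ dZ eZ (leq_trans k10 eZ) hV ev.
have ev1 : env sg N (sem (build_cmd d) s) by apply: env_sem.
have [p1 o1] := @frame_out (build_cmd d) s isT.
rewrite /pass_cmd 2!sem_seq 2!cost_seq [cost_bound _ _]/=.
rewrite pV in p1; rewrite oV in o1.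
move: (sem (build_cmd d) s) h1 e10 ev1 p1 o1 => s1 h1 e10 ev1 p1 o1.
have in1 : inputs sg V1 by move=> r lr; rewrite inV // !lo1 //; clear -lr; lia.
have fl1 : found_list V1 N = found_list V N.
  by apply: eq_found_list => j lj _; apply: lo1.
have sm1 : small Z s1 by apply: env_small ev1 _ _ _ _; rewrite ?e10.
have c2 : cost search_cmd s1 <= cost_bound search_cmd Z by apply: cost_le.
have [V2 [h2 o12 ok2 z2]] := search_holds sSigma h1 in1 ev1 e10.
have ev2 : env sg N (sem search_cmd s1) by apply: env_sem.
have f10 : rg (sem search_cmd s1) 10 = N.+1 ^ d by rewrite frame.
have [p2 o2] := @frame_out search_cmd s1 isT.
rewrite p1 in p2; rewrite o1 in o2.
move: (sem search_cmd s1) h2 ok2 z2 ev2 f10 p2 o2 => s2 h2 ok2 z2 ev2 f10 p2 o2.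
have fl2 : found_list V2 N = found_list V N.
  by rewrite -fl1; apply: eq_found_list => j _ lj; apply: o12; rewrite ltnNge lj andbF.
split.
  apply: leq_add => //; apply: leq_add => //.
  have sm2 : small Z s2 by apply: env_small ev2 _ _ _ _; rewrite ?f10.
  rewrite -[X in X <= _]/(cost (If 11 emit_cmd) s2).
  by apply: (@cost_le (If 11 emit_cmd)).
case: ok2 => [z|[z irrF freshF]].
- left; rewrite sem_if_false //; split=> //.
  exists (found_list V N); split=> //; first by rewrite size_mkseq.
  (* The sets tried are the [N.+1 ^ d] slots after the list; by [z2], none of them gives a new
     irreducible set for any [x]. *)
  have H := irr_complete (L := in_list sg N V1)
    (W := fun S => exists2 c, c < N.+1 ^ d & V1 (jL + N + c) = S) acyclicSigma dimSigma cov1.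
  move=> M MI; have /existsP[j /eqP eM] : in_list sg N V1 M.
    apply: H MI => S x [c lc <-] Sx; apply: contraT => /negP nin; exfalso.
    apply: (z2 z c lc x); split=> // j lj ej.
    by apply: nin; apply/existsP; exists (Ordinal lj); rewrite /= ej.
  by rewrite -fl1 -eM; apply: (map_f (fun j => V1 (jL + j))); rewrite mem_iota /=.
- right; rewrite sem_if_true ?z //.
  have [h3 ev3 p3 o3] := emit_holds h2 ev2 p2.
  have f11 : rg (sem emit_cmd s2) 11 = 1 by rewrite frame.
  have f10' : rg (sem emit_cmd s2) 10 = N.+1 ^ d by rewrite frame.
  move: (sem emit_cmd s2) h3 ev3 p3 o3 f11 f10' => s3 h3 ev3 p3 o3 f11 f10'.
  split; first by rewrite f11.
  have fl3 : found_list (setslot V2 (jL + N) (V2 jF)) N.+1 = rcons (found_list V N) (V2 jF).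
    have e : found_list (setslot V2 (jL + N) (V2 jF)) N = found_list V2 N.
      by apply: eq_found_list => j lj _; rewrite setslotN // ltn_eqF.
    by rewrite -fl2 -e [LHS]mkseqS setslotE.
  exists (setslot V2 (jL + N) (V2 jF)); split=> //.
  + apply: inputs_setslot; first by rewrite -addn3 -addnA leq_addr.
    exact: outside_scratch_inputs o12 in1.
  + rewrite f10'; elim: (d) => // k IHk; rewrite !expnS leq_mul //.
  + rewrite fl3; split=> //.
    * by rewrite o3 o2 map_rcons.
    * rewrite rcons_uniq uV andbT -fl2; apply/mapP => -[j]; rewrite mem_iota => lj ej.
      by apply: (freshF j) => //.
    * by move=> M; rewrite mem_rcons inE => /orP[/eqP->|/sV].
Qed.

End Enumeration.

Opaque pass_cmd.

Lemma ptr0 n : ptr n 0 = 2.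
Proof. by rewrite -[ptr n 0]/(2 + 0 * n). Qed.

Lemma setup_ready n (sg : seq (implication 'I_n)) Sigma d s :
  rg s =1 (fun=> 0) -> mm s = nth 0 (encode_base sg) -> pd s = [::] -> ot s = [::] ->
  ready sg Sigma d 0 (sem setup_cmd s).
Proof.
move=> r0 em p0 o0; rewrite /setup_cmd 2!sem_seq.
pose V j := nth set0 (input_sets sg) j.
have hV : holds s V.
  by rewrite /holds em; split; [exact: bitmem_encode_base|exact: slot_encode_base].
have h1 : holds (sem setup_init s) V by rewrite /setup_init 4!sem_seq; do 5!apply: holds_ins => //.
have f2 : rg (sem setup_init s) 2 = n by regs; rewrite em.
have f3 : rg (sem setup_init s) 3 = size sg by regs; rewrite em.
have f5 : rg (sem setup_init s) 5 = 2 by [].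
have f10 : rg (sem setup_init s) 10 = 0 by rewrite frame.
have p1 : pd (sem setup_init s) = [::] by [].
have o1 : ot (sem setup_init s) = [::] by [].
move: (sem setup_init s) h1 f2 f3 f5 f10 p1 o1 => s1 h1 f2 f3 f5 f10 p1 o1.
pose I k s' := holds s' V /\ rg s' 5 = ptr n k.*2.
have := @for_rule I 23 3 setup_body s1; rewrite f3 => /(_ _ _)[].
- by split; rewrite // for_init_rg // f5 ptr0.
- move=> k s' _ fr [h5 e5]; have g2 : rg s' 2 = n by rewrite fr.
  split; first by apply: holds_dec; rewrite /setup_body sem_seq; do 2!apply: holds_ins => //.
  by regs; rewrite e5 g2 !ptrS doubleS.
- have g2 : rg (sem (For 23 3 setup_body) s1) 2 = n by rewrite frame.
  have g3 : rg (sem (For 23 3 setup_body) s1) 3 = size sg by rewrite frame.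
  have g10 : rg (sem (For 23 3 setup_body) s1) 10 = 0 by rewrite frame.
  have [] := @frame_out (For 23 3 setup_body) s1 isT; rewrite p1 o1.
  move: (sem (For _ _ _) s1) g2 g3 g10 => s2 g2 g3 g10 p2 o2 h2 e5.
  exists V; split.
  + by rewrite /setup_end /copy 5!sem_seq; do 6!apply: holds_ins => //.
  + exact: nth_input_sets.
  + by split; regs; rewrite ?e5 ?g2 ?addn0 ?add0n ?ptrS.
  + by rewrite frame // g10.
  + by split.
Qed.

(** * Polynomial bounds and monotonicity of runs *)

Lemma cost_bound_mono c Z Z' : Z <= Z' -> cost_bound c Z <= cost_bound c Z'.
Proof.
move=> le; elim: c => //= [c1 H1 c2 H2|k a c H]; first exact: leq_add.
by rewrite leq_add2l leq_mul // leq_add2r.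
Qed.

Definition is_poly (f : nat -> nat) : Prop :=
  exists p : {poly nat}, forall z, (p.[z])%R = f z.

Lemma is_poly_const k : is_poly (fun=> k).
Proof. by exists (k%:P)%R => z; rewrite hornerC. Qed.

Lemma is_poly_id : is_poly id.
Proof. by exists 'X%R => z; rewrite hornerX. Qed.

Lemma is_polyD f g : is_poly f -> is_poly g -> is_poly (fun z => f z + g z).
Proof. by move=> [p hp] [q hq]; exists (p + q)%R => z; rewrite hornerD hp hq. Qed.

Lemma is_polyM f g : is_poly f -> is_poly g -> is_poly (fun z => f z * g z).
Proof. by move=> [p hp] [q hq]; exists (p * q)%R => z; rewrite hornerM hp hq. Qed.

Lemma is_polyX f k : is_poly f -> is_poly (fun z => f z ^ k).
Proof.
move=> hf; elim: k => [|k [p hp]]; first exact: is_poly_const.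
by have [q hq] := is_polyM hf (ex_intro _ p hp); exists q => z; rewrite hq expnS.
Qed.

Lemma is_poly_cost_bound c f : is_poly f -> is_poly (fun z => cost_bound c (f z)).
Proof.
move=> hf; elim: c => [i|c1 H1 c2 H2|a c H|k a c H] /=.
- exact: is_poly_const.
- exact: is_polyD.
- exact: is_polyD (is_poly_const 1) H.
- apply: is_polyD (is_poly_const 3) (is_polyM hf _).
  exact: is_polyD H (is_poly_const 4).
Qed.

Lemma outputs_step P c : size (outputs c) <= size (outputs (step P c)).
Proof.
rewrite /step; case: (onth P (pc c)) => // i.
by case: c => l r m w o; case: i => //= *; rewrite size_rcons.
Qed.

Lemma outputs_mono P input t t' : t <= t' ->
  size (outputs (run P input t)) <= size (outputs (run P input t')).
Proof.
move=> /subnK <-; rewrite /run iterD; elim: (t' - t) => // k IH.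
exact: leq_trans IH (outputs_step _ _).
Qed.

Lemma halted_run P input t t' : t <= t' -> halted P (run P input t) ->
  run P input t' = run P input t.
Proof.
move=> /subnK <- h; rewrite /run iterD; elim: (t' - t) => //= k ->.
by rewrite /step onth_default.
Qed.

(** * The enumeration program *)

Definition start_label : nat := size (compile setup_cmd 0).
Definition test_label d : nat := start_label + size (compile (pass_cmd d) start_label).

(** The number of passes is not known in advance, so their loop cannot be a [For]. The target of
    [JumpZ] is the end of the program. *)
Definition enum_prog d : program :=
  compile setup_cmd 0 ++ compile (pass_cmd d) start_label ++
  [:: JumpZ 11 (test_label d).+2; Jump start_label].

(** With [z] the sum of [n], the number of implications and N, this exceeds every loop bound of a
    pass, including [d] and the final size of the family; a sum, unlike a maximum, stays
    polynomial. *)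
Definition loop_bound d z : nat := z.+1 ^ d + z + d.
Definition pass_time d z : nat := cost_bound (pass_cmd d) (loop_bound d z) + 2.
(** Finding N sets and then none takes N + 1 passes, and N is at most [z]. *)
Definition enum_time d z : nat := cost_bound setup_cmd z + z.+1 * pass_time d z.

Lemma is_poly_enum_time d : is_poly (enum_time d).
Proof.
have pS : is_poly S.
  by have [p hp] := is_polyD (is_poly_const 1) is_poly_id; exists p => z; rewrite hp add1n.
have pSd := is_polyX d pS.
have pL : is_poly (loop_bound d).
  exact: is_polyD (is_polyD pSd is_poly_id) (is_poly_const d).
have pP := is_polyD (is_poly_cost_bound (pass_cmd d) pL) (is_poly_const 2).
exact: is_polyD (is_poly_cost_bound setup_cmd is_poly_id) (is_polyM pS pP).
Qed.

Lemma pass_time_mono d z z' : z <= z' -> pass_time d z <= pass_time d z'.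
Proof.
move=> le; rewrite leq_add2r; apply: cost_bound_mono.
rewrite leq_add2r leq_add //; elim: d => // d IH; rewrite !expnS leq_mul //.
Qed.

Lemma embedded_setup d : embedded (enum_prog d) 0 (compile setup_cmd 0).
Proof. by exists [::]; eexists; split; exact: erefl. Qed.

Lemma embedded_pass d : embedded (enum_prog d) start_label (compile (pass_cmd d) start_label).
Proof. by exists (compile setup_cmd 0); eexists; split; exact: erefl. Qed.

Lemma embedded_test d : embedded (enum_prog d) (test_label d)
  [:: JumpZ 11 (test_label d).+2; Jump start_label].
Proof.
exists (compile setup_cmd 0 ++ compile (pass_cmd d) start_label), [::].
by rewrite cats0 -catA size_cat.
Qed.

Lemma size_enum_prog d : size (enum_prog d) = (test_label d).+2.
Proof. by rewrite /enum_prog 2!size_cat addnA -[RHS]addn2. Qed.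

Lemma wf_setup : wf setup_cmd.
Proof. by vm_compute. Qed.

Lemma wf_pass d : wf (pass_cmd d).
Proof. by vm_compute. Qed.

Opaque start_label test_label enum_prog.

Section Run.
Variables (d n : nat) (sg : seq (implication 'I_n)) (Sigma : {set implication 'I_n}).
Hypothesis sSigma : sg =i Sigma.
Hypothesis acyclicSigma : acyclic Sigma.
Hypothesis dimSigma : forall x, dual_dimension (premises Sigma x) <= d.

Notation P := (enum_prog d).
Notation input := (encode_base sg).
Notation size_in N := (n + size sg + N).

Lemma run_setup : exists t s, [/\ t <= cost_bound setup_cmd (size_in 0),
  run P input t = conf start_label s & ready sg Sigma d 0 s].
Proof.
pose s0 := State (fun=> 0) (nth 0 input) [::] [::].
exists (cost setup_cmd s0), (sem setup_cmd s0); split; last exact: setup_ready.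
  rewrite /setup_cmd 2!cost_seq; apply: leq_add => //; apply: leq_add => //.
  apply: cost_boundP => //=; rewrite andbT; exact: leq_trans (leq_addl _ _) (leq_addr _ _).
by rewrite /run -[init input]/(conf 0 s0) (comp_correct _ wf_setup (embedded_setup d)).
Qed.

Opaque setup_cmd.

Lemma run_pass N s : ready sg Sigma d N s ->
  exists t s', t <= pass_time d (size_in N) /\
    ([/\ iter t (step P) (conf start_label s) = conf (test_label d).+2 s' &
       finished Sigma N s'] \/
     [/\ iter t (step P) (conf start_label s) = conf start_label s' &
       ready sg Sigma d N.+1 s']).
Proof.
move=> rdy; pose Z := loop_bound d (size_in N).
have b1 : size_in N <= Z by exact: leq_trans (leq_addl _ _) (leq_addr _ _).
have b2 : d <= Z by rewrite /Z /loop_bound leq_addl.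
have b3 : N.+1 ^ d <= Z.
  rewrite /Z /loop_bound -addnA; apply: leq_trans (leq_addr _ _).
  elim: (d) => // k IH; rewrite !expnS leq_mul // ltnS; exact: leq_addl.
have b4 : n <= Z by apply: leq_trans b1; rewrite -addnA leq_addr.
have b5 : size sg <= Z by apply: leq_trans b1; rewrite addnAC leq_addl.
have b6 : N <= Z by apply: leq_trans b1; rewrite leq_addl.
have [c H] := pass_ready sSigma acyclicSigma dimSigma b4 b5 b6 b2 b3 rdy.
have := comp_correct s (wf_pass d) (embedded_pass d); rewrite -/(test_label d).
move: (cost _ _) (sem _ _) c H => t s' c H rt.
have jump : step P (conf (test_label d) s') =
    conf (if rg s' 11 == 0 then (test_label d).+2 else (test_label d).+1) s'.
  by rewrite (embedded_step (embedded_test d)).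
case: H => -[e11 H].
- exists t.+1, s'; split; first by rewrite /pass_time addn2 ltnS (leq_trans c) // leqnSn.
  left; split; last exact: H.
  rewrite iterS rt jump e11 eqxx; exact: erefl.
- exists t.+2, s'; split; first by rewrite /pass_time addn2 !ltnS.
  right; split; last exact: H; rewrite !iterS rt jump ifN; last exact/eqP.
  have := embedded_catr (embedded_test d : embedded _ _ ([:: _] ++ _)).
  by rewrite addn1 => /embedded_step ->.
Qed.

Lemma ready_leq N s : ready sg Sigma d N s -> N <= #|irr Sigma| /\ size (ot s) = N.
Proof.
case=> V [_ _ _ _ [_ e u sub]]; rewrite e size_map size_mkseq; split=> //.
rewrite -[N](size_mkseq (fun j => V ((size sg).*2.+3 + j))) cardE.
by apply: uniq_leq_size u _ => A /sub; rewrite mem_enum.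
Qed.

(** While fewer than [#|irr Sigma|] sets are listed, a pass cannot finish, since a finished list
    contains all of them. *)
Lemma run_ready N : N <= #|irr Sigma| ->
  exists t s, [/\ t <= cost_bound setup_cmd (size_in N) + N * pass_time d (size_in N),
    run P input t = conf start_label s & ready sg Sigma d N s].
Proof.
elim: N => [_|N IH lN].
  by have [t [s [le e r]]] := run_setup; exists t, s; rewrite mul0n addn0.
have [t [s [le e r]]] := IH (ltnW lN).
have [t' [s' [le' [[e' [l [sl _ sub]]]|[e' r']]]]] := run_pass r.
  move: lN; rewrite -sl cardE ltnNge => /negP[].
  by apply: uniq_leq_size (enum_uniq _) _ => A; rewrite mem_enum => /sub.
exists (t' + t), s'; split; [|by rewrite /run iterD -/(run P input t) e; exact: e'|exact: r'].
have lt : size_in N <= size_in N.+1 by rewrite leq_add2l.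
rewrite mulSn addnCA; apply: leq_add; first exact: leq_trans le' (pass_time_mono _ lt).
apply: leq_trans le _; apply: leq_add; first exact: cost_bound_mono.
by rewrite leq_mul2l pass_time_mono ?orbT.
Qed.

Lemma enum_prog_correct :
  enumerates_within P input (encode_family (irr Sigma)) (fun i => enum_time d (size_in i)).
Proof.
have sz : size (encode_family (irr Sigma)) = #|irr Sigma| by rewrite size_map cardE.
have tm i : cost_bound setup_cmd (size_in i) + i.+1 * pass_time d (size_in i)
    <= enum_time d (size_in i).
  by rewrite leq_add2l leq_mul2r ltnS leq_addl orbT.
split; rewrite sz.
  (* When the machine is ready with [i] sets, [i] words are out, and later steps never remove
     one. *)
  move=> i li; have [t [s [le e r]]] := run_ready li.
  have [_ so] := ready_leq r; rewrite -{1}so -[ot s]/(outputs (conf start_label s)) -e.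
  apply: outputs_mono; apply: leq_trans le (leq_trans _ (tm i)).
  by rewrite leq_add2l leq_mul2r leqnSn orbT.
have [t [s [le e r]]] := run_ready (leqnn _).
(* One pass more: it cannot find a further set, as the list would then outnumber the irreducible
   sets. *)
have [t' [s' [le' [[e' [l [sl [pl ol ul subl] sub]]]|[e' r']]]]] := run_pass r; last first.
  by have [] := ready_leq r'; rewrite ltnn.
have e2 : run P input (t' + t) = conf (test_label d).+2 s'.
  by rewrite /run iterD -/(run P input t) e; exact: e'.
have h : halted P (run P input (t' + t)) by rewrite e2 /halted size_enum_prog; exact: leqnn.
rewrite (halted_run _ h); last first.
  by apply: leq_trans (tm _); rewrite mulSn addnCA leq_add.
cbv zeta; split; [exact: h|by rewrite e2; exact: pl|rewrite e2].
rewrite -[outputs _]/(ot s') ol; apply: perm_map.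
apply: uniq_perm; rewrite ?enum_uniq // => A; rewrite mem_enum.
by apply/idP/idP => [/subl|/sub].
Qed.

End Run.

Theorem theorem24 (d : nat) :
  exists (P : program) (p : {poly nat}),
    forall (n : nat) (Sigma : {set implication 'I_n}),
      implicational_base Sigma ->
      acyclic Sigma ->
      (forall x : 'I_n, dual_dimension (premises Sigma x) <= d) ->
      forall s : seq (implication 'I_n), uniq s -> s =i Sigma ->
        enumerates_within P (encode_base s) (encode_family (irr Sigma))
          (fun i => (p.[(n + #|Sigma| + i)%N])%R).
Proof.
have [p hp] := is_poly_enum_time d; exists (enum_prog d), p.
move=> n Sigma _ acy dim s us sS.
have -> : #|Sigma| = size s by rewrite -(card_uniqP us); apply: eq_card => r; rewrite sS.
have [H1 H2] := enum_prog_correct sS acy dim.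
by split=> [i li|]; rewrite hp; [apply: H1|].
Qed.
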